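(* Let $m,\ell\in\mathbb{R}$ and let $\Sigma$ be a CMC Hopf cylinder in the Bianchi-Cartan-Vranceanu space $M^3_{m,\ell}$. (i) If $4m\le\ell^2$ and $\Sigma$ is triharmonic, then $\Sigma$ is minimal. (ii) If $4m>\ell^2$ and the geodesic curvature $\kappa_g$ of the base curve of $\Sigma$ verifies $$\kappa_g^2=2(4m-\ell^2),$$ then $\Sigma$ is proper triharmonic.
   Context: For $m,\ell\in\mathbb{R}$ the Bianchi-Cartan-Vranceanu (BCV) space is $M^3_{m,\ell}=(\bar M\times\mathbb{R},g)$, where $\bar M=\{(x,y)\in\mathbb{R}^2: 1+m(x^2+y^2)>0\}$ and $$g=\frac{dx^2+dy^2}{[1+m(x^2+y^2)]^2}+\Big[dz+\frac{\ell}{2}\,\frac{y\,dx-x\,dy}{1+m(x^2+y^2)}\Big]^2 .$$ The map $\pi(x,y,z)=(x,y)$ is a Riemannian submersion of $M^3_{m,\ell}$ onto $M^2(4m)=\big(\bar M,h=\frac{dx^2+dy^2}{[1+m(x^2+y^2)]^2}\big)$, a surface of constant curvature $4m$. Given a smooth curve $\gamma:I\to M^2(4m)$ parametrized by arc length ($I$ an interval), the Hopf cylinder over the base curve $\gamma$ is the surface $\Sigma=\bigcup_{s\in I}\pi^{-1}(\gamma(s))$, parametrized by $(s,t)\mapsto(x(s),y(s),t)$, where $\gamma(s)=(x(s),y(s))$, and regarded as an immersed surface with the induced metric. The geodesic curvature $\kappa_g$ of $\gamma$ is computed in $M^2(4m)$. CMC means that the mean curvature function is constant. Triharmonicity: for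 an isometric immersion $\varphi:M\to N$ between Riemannian manifolds, let $\tau(\varphi)=\mathrm{trace}\,\nabla d\varphi$ be the tension field, $\nabla^\varphi$ the induced connection on $\varphi^{-1}TN$, and $\overline{\Delta}=-\sum_i\big(\nabla^\varphi_{e_i}\nabla^\varphi_{e_i}-\nabla^\varphi_{\nabla^M_{e_i}e_i}\big)$ the rough Laplacian on sections of $\varphi^{-1}TN$, with $\{e_i\}$ a local orthonormal frame tangent to $M$. The curvature convention is $R^N(X,Y)Z=\nabla_X\nabla_YZ-\nabla_Y\nabla_XZ-\nabla_{[X,Y]}Z$. The immersion (submanifold) is called triharmonic ($3$-harmonic) if its $3$-tension field vanishes: $$\tau_3(\varphi)=\overline{\Delta}^2\tau(\varphi)-\sum_iR^N\big(\overline{\Delta}\tau(\varphi),d\varphi(e_i)\big)d\varphi(e_i)-\sum_iR^N\big(\nabla^\varphi_{e_i}\tau(\varphi),\tau(\varphi)\big)d\varphi(e_i)=0 .$$ It is proper triharmonic if it is triharmonic and not minimal. *)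

(* Defs.v *)
From HB Require Import structures.
From mathcomp Require Import all_boot all_order all_algebra.
From mathcomp Require Import all_classical all_reals all_analysis.

Set Implicit Arguments.
Unset Strict Implicit.
Unset Printing Implicit Defensive.

Import Order.TTheory GRing.Theory Num.Theory.
Import numFieldNormedType.Exports.

Local Open Scope classical_set_scope.
Local Open Scope ring_scope.

(* Riemannian geometry in a single global chart: a manifold of dimension n is
   an open subset of R^n, a point and a tangent vector are both row vectors
   (components with respect to the coordinate frame), and a metric is the
   matrix-valued function of its coefficients. Metrics and maps are total
   functions; only their values on the relevant open set matter. *)

Section chart_geometry.
Context {R : realType}.

(* C^oo on the open set W: all iterated partial derivatives exist and are
   (Frechet) differentiable at every point of W. *)
Definition iter_partial {n : nat} {V : normedModType R}
    (s : seq 'I_n) (f : 'rV[R]_n -> V) : 'rV[R]_n -> V :=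
  foldr (fun i h p => 'D_(delta_mx 0 i) h p) f s.

Definition smooth_on {n : nat} {V : normedModType R}
    (W : set 'rV[R]_n) (f : 'rV[R]_n -> V) : Prop :=
  forall (s : seq 'I_n) (p : 'rV[R]_n), W p ->
    differentiable (iter_partial s f) p.

Definition metric (n : nat) : Type := 'rV[R]_n -> 'M[R]_n.

Definition inner {n : nat} (G : 'M[R]_n) (u v : 'rV[R]_n) : R :=
  (u *m G *m v^T) 0 0.

Definition christoffel {n : nat} (g : metric n) (p : 'rV[R]_n)
    (k i j : 'I_n) : R :=
  2^-1 * \sum_(r < n) invmx (g p) k r *
    ('D_(delta_mx 0 i) (fun q => g q j r) p
     + 'D_(delta_mx 0 j) (fun q => g q i r) p
     - 'D_(delta_mx 0 r) (fun q => g q i j) p).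

Definition christoffel_form {n : nat} (g : metric n) (p u v : 'rV[R]_n) :
    'rV[R]_n :=
  \row_k \sum_(i < n) \sum_(j < n) christoffel g p k i j * u 0 i * v 0 j.

(* The connection induced on f^{-1}TN by the Levi-Civita connection of (N, g),
   for f : T -> N: the derivative at p, in the direction u, of the section V.
   T is R for curves and a chart domain in general. *)
Definition nabla_along {n : nat} {T : normedModType R} (g : metric n)
    (f V : T -> 'rV[R]_n) (p u : T) : 'rV[R]_n :=
  'D_u V p + christoffel_form g (f p) ('D_u f p) (V p).

Definition nabla {n : nat} (g : metric n) (X Y : 'rV[R]_n -> 'rV[R]_n)
    (p : 'rV[R]_n) : 'rV[R]_n :=
  nabla_along g id Y p (X p).

Definition lie_bracket {n : nat} (X Y : 'rV[R]_n -> 'rV[R]_n)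
    (p : 'rV[R]_n) : 'rV[R]_n :=
  'D_(X p) Y p - 'D_(Y p) X p.

Definition curvature {n : nat} (g : metric n)
    (X Y Z : 'rV[R]_n -> 'rV[R]_n) (p : 'rV[R]_n) : 'rV[R]_n :=
  nabla g X (nabla g Y Z) p - nabla g Y (nabla g X Z) p
  - nabla g (lie_bracket X Y) Z p.

(* The curvature is tensorial, so its value on tangent vectors u, v, w at p can
   be computed on any vector fields extending them, here the ones with
   constant components. *)
Definition curvature_at {n : nat} (g : metric n) (p u v w : 'rV[R]_n) :
    'rV[R]_n :=
  curvature g (cst u) (cst v) (cst w) p.

Section immersion.
Context {k n : nat}.
Variables (g : metric n) (phi : 'rV[R]_k -> 'rV[R]_n).

Definition induced_metric : metric k := fun p =>
  \matrix_(i, j) inner (g (phi p)) ('D_(delta_mx 0 i) phi p)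
                                   ('D_(delta_mx 0 j) phi p).

Definition orthonormal_frame (W : set 'rV[R]_k)
    (E : 'I_k -> 'rV[R]_k -> 'rV[R]_k) : Prop :=
  [/\ open W,
      forall i, smooth_on W (E i) &
      forall p, W p -> forall i j,
        inner (induced_metric p) (E i p) (E j p) = (i == j)%:R].

Section frame.
Variable E : 'I_k -> 'rV[R]_k -> 'rV[R]_k.

Definition tension (p : 'rV[R]_k) : 'rV[R]_n :=
  \sum_(i < k)
    (nabla_along g phi (fun q => 'D_(E i q) phi q) p (E i p)
     - 'D_(nabla induced_metric (E i) (E i) p) phi p).

Definition rough_laplacian (V : 'rV[R]_k -> 'rV[R]_n) (p : 'rV[R]_k) :
    'rV[R]_n :=
  - \sum_(i < k)
    (nabla_along g phi (fun q => nabla_along g phi V q (E i q)) p (E i p)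
     - nabla_along g phi V p (nabla induced_metric (E i) (E i) p)).

Definition tritension (p : 'rV[R]_k) : 'rV[R]_n :=
  rough_laplacian (rough_laplacian tension) p
  - \sum_(i < k) curvature_at g (phi p)
      (rough_laplacian tension p) ('D_(E i p) phi p) ('D_(E i p) phi p)
  - \sum_(i < k) curvature_at g (phi p)
      (nabla_along g phi tension p (E i p)) (tension p) ('D_(E i p) phi p).

Definition mean_curvature_vector (p : 'rV[R]_k) : 'rV[R]_n :=
  k%:R^-1 *: tension p.

End frame.

(* All the fields above are independent of the orthonormal frame; properties of
   the immersion are required in every local orthonormal frame. *)
Variable D : set 'rV[R]_k.

Definition local_frame (W : set 'rV[R]_k)
    (E : 'I_k -> 'rV[R]_k -> 'rV[R]_k) : Prop :=
  W `<=` D /\ orthonormal_frame W E.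

Definition triharmonic : Prop :=
  forall W E, local_frame W E -> forall p, W p -> tritension E p = 0.

Definition minimal : Prop :=
  forall W E, local_frame W E -> forall p, W p -> mean_curvature_vector E p = 0.

Definition proper_triharmonic : Prop := triharmonic /\ ~ minimal.

Definition unit_normal (N : 'rV[R]_k -> 'rV[R]_n) : Prop :=
  smooth_on D N /\
  forall p, D p ->
    inner (g (phi p)) (N p) (N p) = 1 /\
    forall u, inner (g (phi p)) (N p) ('D_u phi p) = 0.

(* The mean curvature function of a hypersurface with unit normal N. *)
Definition mean_curvature (N : 'rV[R]_k -> 'rV[R]_n)
    (E : 'I_k -> 'rV[R]_k -> 'rV[R]_k) (p : 'rV[R]_k) : R :=
  inner (g (phi p)) (mean_curvature_vector E p) (N p).

Definition cmc : Prop :=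
  exists N, unit_normal N /\
  exists c : R, forall W E, local_frame W E ->
    forall p, W p -> mean_curvature N E p = c.

End immersion.
End chart_geometry.

Arguments metric R n : clear implicits.

Section bianchi_cartan_vranceanu.
Context {R : realType}.
Variables (m l : R).

Definition bcv_factor (x y : R) : R := 1 + m * (x ^+ 2 + y ^+ 2).

Definition base_domain : set 'rV[R]_2 :=
  [set p | 0 < bcv_factor (p 0 0) (p 0 1)].

Definition base_metric : metric R 2 := fun p =>
  (bcv_factor (p 0 0) (p 0 1) ^- 2)%:M.

(* The 1-form dz + (l/2) (y dx - x dy) / (1 + m (x^2 + y^2)). *)
Definition bcv_form (p : 'rV[R]_3) : 'rV[R]_3 :=
  let x := p 0 0 in let y := p 0 1 in
  \row_(j < 3) [:: l / 2 * (y / bcv_factor x y);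
                   - (l / 2 * (x / bcv_factor x y)); 1]`_j.

(* Each summand is the Gram matrix w^T w of the square of a 1-form w. *)
Definition bcv_metric : metric R 3 := fun p =>
  let dx : 'rV[R]_3 := delta_mx 0 0 in
  let dy : 'rV[R]_3 := delta_mx 0 1 in
  bcv_factor (p 0 0) (p 0 1) ^- 2 *: (dx^T *m dx + dy^T *m dy)
  + (bcv_form p)^T *m bcv_form p.

Definition arclength_curve (I : set R) (gamma : R -> 'rV[R]_2) : Prop :=
  [/\ forall (j : nat) (s : R), I s -> derivable (derive1n j gamma) s 1,
      forall s, I s -> base_domain (gamma s) &
      forall s, I s ->
        inner (base_metric (gamma s)) (derive1 gamma s) (derive1 gamma s) = 1].

(* base_metric is conformal to the Euclidean metric, so the Euclidean rotation
   by a right angle is also its complex structure, and rotates the unit tangent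
   to the unit normal. *)
Definition rot90 (u : 'rV[R]_2) : 'rV[R]_2 :=
  \row_(j < 2) [:: - u 0 1; u 0 0]`_j.

Definition geodesic_curvature (gamma : R -> 'rV[R]_2) (s : R) : R :=
  inner (base_metric (gamma s))
    (nabla_along base_metric gamma (derive1 gamma) s 1) (rot90 (derive1 gamma s)).

Definition hopf_cylinder (gamma : R -> 'rV[R]_2) (p : 'rV[R]_2) : 'rV[R]_3 :=
  let s := p 0 0 in let t := p 0 1 in
  \row_(j < 3) [:: gamma s 0 0; gamma s 0 1; t]`_j.

Definition hopf_domain (I : set R) : set 'rV[R]_2 := [set p | I (p 0 0)].

End bianchi_cartan_vranceanu.

(* Main.v *)
Require Import Defs.
From HB Require Import structures.
From mathcomp Require Import all_boot all_order all_algebra.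
From mathcomp Require Import all_classical all_reals all_analysis.
From mathcomp Require Import ring lra.

Set Implicit Arguments.
Unset Strict Implicit.
Unset Printing Implicit Defensive.

Import Order.TTheory GRing.Theory Num.Theory.
Import numFieldNormedType.Exports.

Local Open Scope classical_set_scope.
Local Open Scope ring_scope.

(* Let T, N be the horizontal lifts of the unit tangent and unit normal of the
   base curve and xi the unit vertical field. Along the Hopf cylinder, with
   c = - l / 2 and kappa the geodesic curvature of the base curve,
     nabla_T T = kappa N, nabla_T N = - kappa T - c xi, nabla_T xi = c N,
     nabla_xi T = c N,    nabla_xi N = - c T,           nabla_xi xi = 0,
   and the cylinder is flat with parallel frame (T, xi). Hence the tension field
   is kappa N, so that constant mean curvature means kappa constant; then the
   rough Laplacian multiplies N by kappa^2 + l^2 / 2, and since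
     R(N, T) T = (4 m - 3 l^2 / 4) N, R(N, xi) xi = (l^2 / 4) N,
     R(N, T) xi = R(N, xi) T = 0,
   the 3-tension field equals
     kappa (kappa^2 - 2 (4 m - l^2)) (kappa^2 + l^2 / 4) N. *)

(** The properties of the immersion are required in every local orthonormal frame (E_1, E_2), so the
    computation cannot be restricted to (T, xi). With E_i = w_i T + t_i xi, the derivatives of w_i
    and t_i cancel against nabla_{E_i} E_i, because T and xi are parallel on the cylinder. What
    remains is quadratic in (w_i, t_i) and is summed by the orthonormality relations: sum w_i^2 =
    sum t_i^2 = 1 and sum w_i t_i = 0. In the other direction, (T, xi) itself has to be shown to be
    a smooth frame, since a hypothesis about all frames yields nothing until one is exhibited. Every
    geometric identity becomes a polynomial identity in the derivatives of the base curve, modulo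
    two relations: the definition of the conformal factor and the unit speed. *)

Section pointwise_derivatives.
Context {R : realType} {V : normedModType R}.
Implicit Types (f g : V -> R) (p v : V).

Lemma is_derive_fun_cst p v (k : R) : is_derive p v (fun _ => k) 0.
Proof. exact: is_derive_cst. Qed.

Lemma is_derive_fun_add p v f g df dg :
  is_derive p v f df -> is_derive p v g dg ->
  is_derive p v (fun q => f q + g q) (df + dg).
Proof. exact: is_deriveD. Qed.

Lemma is_derive_fun_opp p v f df :
  is_derive p v f df -> is_derive p v (fun q => - f q) (- df).
Proof. exact: is_deriveN. Qed.

Lemma is_derive_fun_mul p v f g df dg :
  is_derive p v f df -> is_derive p v g dg ->
  is_derive p v (fun q => f q * g q) (f p * dg + g p * df).
Proof. exact: is_deriveM. Qed.

Lemma is_derive_fun_exp p v f df n :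
  is_derive p v f df ->
  is_derive p v (fun q => f q ^+ n) (n%:R * f p ^+ n.-1 * df).
Proof.
move=> fd; have -> : (fun q => f q ^+ n) = f ^+ n by rewrite exprfctE.
by apply: is_derive_eq.
Qed.

Lemma is_derive_fun_inv p v f df : f p != 0 ->
  is_derive p v f df -> is_derive p v (fun q => (f q)^-1) (- f p ^- 2 * df).
Proof.
move=> fp0 [fd fv]; split; first exact: derivableV.
by rewrite deriveV // fv.
Qed.

Lemma is_derive_row n (M : V -> 'rV[R]_n) (dM : 'rV[R]_n) p v :
  (forall j, is_derive p v (fun q => M q 0 j) (dM 0 j)) -> is_derive p v M dM.
Proof.
move=> Md; have dM' : derivable M p v.
  by apply/derivable_mxP => i j; rewrite ord1; case: (Md j).
split => //; rewrite derive_mx //; apply/matrixP => i j; rewrite !mxE ord1.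
by case: (Md j).
Qed.

Lemma is_derive_row_entry n (M : V -> 'rV[R]_n) (dM : 'rV[R]_n) p v j :
  is_derive p v M dM -> is_derive p v (fun q => M q 0 j) (dM 0 j).
Proof.
move=> [Md <-]; split; first by move/derivable_mxP: Md; apply.
by rewrite derive_mx // mxE.
Qed.

End pointwise_derivatives.

(* [notypeclasses refine] keeps the library instances from solving the premises:
   they would express the derivative with [*:], which [ring] does not see. *)
Ltac is_derive_step :=
  match goal with
  | H : is_derive ?p ?v ?f _ |- is_derive ?p ?v ?f _ => exact H
  | H : forall u, is_derive ?p u ?f _ |- is_derive ?p _ ?f _ => exact (H _)
  | |- is_derive _ _ (fun q => ?k) _ => exact (is_derive_fun_cst _ _ k)
  | |- is_derive _ _ (fun q => @?f q + @?g q) _ =>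
      notypeclasses refine (@is_derive_fun_add _ _ _ _ f g _ _ _ _)
  | |- is_derive _ _ (fun q => - @?f q) _ =>
      notypeclasses refine (@is_derive_fun_opp _ _ _ _ f _ _)
  | |- is_derive _ _ (fun q => @?f q * @?g q) _ =>
      notypeclasses refine (@is_derive_fun_mul _ _ _ _ f g _ _ _ _)
  | |- is_derive _ _ (fun q => @?f q ^+ ?n) _ =>
      notypeclasses refine (@is_derive_fun_exp _ _ _ _ f _ n _)
  end.

Ltac is_derive_tac :=
  notypeclasses refine (is_derive_eq _ _); [by repeat is_derive_step | rewrite /=].

(* The Koszul formula contracted with the metric: it determines the
   Christoffel form without inverting the metric. *)
Lemma christoffel_formP (R : realType) (n : nat) (g : metric R n)
    (dg : 'I_n -> 'M[R]_n) (p u v G : 'rV[R]_n) :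
  g p \in unitmx -> (g p)^T = g p ->
  (forall r i j, is_derive p (delta_mx 0 r) (fun q => g q i j) (dg r i j)) ->
  (forall r, 2 * (G *m g p) 0 r =
     \sum_(i < n) \sum_(j < n)
       (dg i j r + dg j i r - dg r i j) * u 0 i * v 0 j) ->
  christoffel_form g p u v = G.
Proof.
move=> gu gT dgE GE.
have igT : (invmx (g p))^T = invmx (g p) by rewrite trmx_inv gT.
(* [G] is written as [G *m g p *m invmx (g p)], so that the hypothesis on [G *m g p] applies
   entrywise. *)
rewrite -[G in RHS](mulmxK gu).
apply/rowP => k; rewrite /christoffel_form !mxE.
have E r : (G *m g p) 0 r = 2^-1 * \sum_(i < n) \sum_(j < n)
       (dg i j r + dg j i r - dg r i j) * u 0 i * v 0 j.
  by rewrite -GE mulKf // pnatr_eq0.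
under [RHS]eq_bigr => r _ do rewrite E.
have C h i j : christoffel g p h i j = 2^-1 * \sum_(r < n)
    invmx (g p) h r * (dg i j r + dg j i r - dg r i j).
  congr (_ * _); apply: eq_bigr => r _.
  by rewrite (@derive_val _ _ _ _ _ _ _ (dgE i j r))
    (@derive_val _ _ _ _ _ _ _ (dgE j i r)) (@derive_val _ _ _ _ _ _ _ (dgE r i j)).
transitivity (\sum_(i < n) \sum_(j < n) 2^-1 * (\sum_(r < n)
    invmx (g p) k r * (dg i j r + dg j i r - dg r i j)) * u 0 i * v 0 j).
  by apply: eq_bigr => i _; apply: eq_bigr => j _; rewrite C.
under [RHS]eq_bigr => r _ do rewrite -[in invmx _ r k]igT mxE.
under [RHS]eq_bigr => r _ do rewrite big_distrr big_distrl /=.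
rewrite [RHS]exchange_big /=; apply: eq_bigr => i _.
under [RHS]eq_bigr => r _ do rewrite big_distrr big_distrl /=.
rewrite [RHS]exchange_big /=; apply: eq_bigr => j _.
rewrite -!mulrA big_distrl /= big_distrr /=; apply: eq_bigr => r _; ring.
Qed.

Lemma is_derive_coord (R : realType) n (p u : 'rV[R]_n) j :
  is_derive p u (fun q => q 0 j) (u 0 j).
Proof. exact: is_derive_row_entry (is_derive_id _ _). Qed.

(** * The Levi-Civita connection of the BCV metric *)

(* Locked, lest [rewrite] identify it with the unfolding of [bcv_form]. *)
HB.lock Definition vec3 (R : realType) (a b c : R) : 'rV[R]_3 :=
  \row_(j < 3) [:: a; b; c]`_j.

Section bcv_connection.
Context {R : realType}.
Implicit Types (p q u v w : 'rV[R]_3) (m l x y a b c : R).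

Lemma vec30 a b c : vec3 a b c 0 0 = a. Proof. by rewrite unlock mxE. Qed.
Lemma vec31 a b c : vec3 a b c 0 1 = b. Proof. by rewrite unlock mxE. Qed.
Lemma vec32 a b c : vec3 a b c 0 2 = c. Proof. by rewrite unlock mxE. Qed.
Definition vec3E := (vec30, vec31, vec32).

Lemma ord3_ind (P : 'I_3 -> Prop) : P 0 -> P 1 -> P 2 -> forall i, P i.
Proof.
move=> P0 P1 P2 [[|[|[|//]]] Hi].
- by rewrite (_ : Ordinal Hi = 0) //; apply: val_inj.
- by rewrite (_ : Ordinal Hi = 1) //; apply: val_inj.
- by rewrite (_ : Ordinal Hi = 2) //; apply: val_inj.
Qed.

Lemma sum3 (f : 'I_3 -> R) : \sum_(i < 3) f i = f 0 + f 1 + f 2.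
Proof.
rewrite !big_ord_recl big_ord0 addr0 addrA.
by congr (f _ + f _ + f _); apply: val_inj.
Qed.

Lemma is_derive_bcv_factor_inv m p u : bcv_factor m (p 0 0) (p 0 1) != 0 ->
  is_derive p u (fun q => (bcv_factor m (q 0 0) (q 0 1))^-1)
    (- 2 * m * (bcv_factor m (p 0 0) (p 0 1))^-1 ^+ 2 *
     (p 0 0 * u 0 0 + p 0 1 * u 0 1)).
Proof.
move=> F0; have d0 := is_derive_coord p u 0; have d1 := is_derive_coord p u 1.
notypeclasses refine (is_derive_eq (@is_derive_fun_inv _ _ _ _
  (fun q => bcv_factor m (q 0 0) (q 0 1)) _ F0 _) _).
  rewrite /bcv_factor; by repeat is_derive_step.
rewrite /= exprVn; ring.
Qed.

(* The suffixes D and DD denote directional derivatives: first at [p] along [u],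
   then along [d]. *)
Definition bcv_formD m l p u : 'rV[R]_3 :=
  let x := p 0 0 in let y := p 0 1 in
  let lam := (bcv_factor m x y)^-1 in
  let dlam := - 2 * m * lam ^+ 2 * (x * u 0 0 + y * u 0 1) in
  vec3 (l / 2 * (u 0 1 * lam + y * dlam)) (- (l / 2 * (u 0 0 * lam + x * dlam))) 0.

Lemma is_derive_bcv_form m l p u j : bcv_factor m (p 0 0) (p 0 1) != 0 ->
  is_derive p u (fun q => bcv_form m l q 0 j) (bcv_formD m l p u 0 j).
Proof.
move=> F0; have d0 := is_derive_coord p u 0; have d1 := is_derive_coord p u 1.
have dl := is_derive_bcv_factor_inv u F0.
have E q : bcv_form m l q = vec3 (l / 2 * (q 0 1 / bcv_factor m (q 0 0) (q 0 1)))
    (- (l / 2 * (q 0 0 / bcv_factor m (q 0 0) (q 0 1)))) 1 by rewrite unlock.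
have Ej k : (fun q => bcv_form m l q 0 k) = fun q =>
    vec3 (l / 2 * (q 0 1 / bcv_factor m (q 0 0) (q 0 1)))
      (- (l / 2 * (q 0 0 / bcv_factor m (q 0 0) (q 0 1)))) 1 0 k.
  by apply/funext => q; rewrite E.
rewrite Ej; move: j; apply: ord3_ind; rewrite vec3E;
  under eq_fun do rewrite vec3E.
- is_derive_tac; ring.
- is_derive_tac; ring.
- exact: is_derive_fun_cst.
Qed.

Definition horizontal_delta (i j : 'I_3) : R :=
  (i == 0)%:R * (j == 0)%:R + (i == 1)%:R * (j == 1)%:R.

Lemma bcv_metricE m l q i j : bcv_metric m l q i j =
  (bcv_factor m (q 0 0) (q 0 1))^-1 ^+ 2 * horizontal_delta i j
  + bcv_form m l q 0 i * bcv_form m l q 0 j.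
Proof. by rewrite !mxE !big_ord1 !mxE -exprVn /= ?mul1r. Qed.

Definition bcv_metricD m l p u : 'M[R]_3 :=
  let lam := (bcv_factor m (p 0 0) (p 0 1))^-1 in
  \matrix_(i, j)
   (- 4 * m * lam ^+ 3 * (p 0 0 * u 0 0 + p 0 1 * u 0 1) * horizontal_delta i j
    + (bcv_form m l p 0 i * bcv_formD m l p u 0 j +
       bcv_formD m l p u 0 i * bcv_form m l p 0 j)).

Lemma is_derive_bcv_metric m l p u i j : bcv_factor m (p 0 0) (p 0 1) != 0 ->
  is_derive p u (fun q => bcv_metric m l q i j) (bcv_metricD m l p u i j).
Proof.
move=> F0; have dl := is_derive_bcv_factor_inv u F0.
have di := is_derive_bcv_form l u i F0; have dj := is_derive_bcv_form l u j F0.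
under eq_fun do rewrite bcv_metricE.
by is_derive_tac; rewrite [bcv_metricD _ _ _ _ _ _]mxE; ring.
Qed.

(** The Christoffel form of a conformal metric lam^2 (dx^2 + dy^2): with f = log lam it is df(u) v +
    df(v) u - <u, v> grad f, and here df(u) = - 2 m lam <p, u>. *)
Definition bcv_conformal m p u v (j : 'I_3) : R :=
  let x := p 0 0 in let y := p 0 1 in
  - 2 * m * (bcv_factor m x y)^-1 *
  ((x * u 0 0 + y * u 0 1) * v 0 j + (x * v 0 0 + y * v 0 1) * u 0 j
   - (u 0 0 * v 0 0 + u 0 1 * v 0 1) * p 0 j).

Definition bcv_omega m l p u : R :=
  bcv_form m l p 0 0 * u 0 0 + bcv_form m l p 0 1 * u 0 1 + u 0 2.

(* The twist of the horizontal distribution enters the horizontal part as a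
   magnetic force; the vertical part makes [bcv_omega] of the result the
   symmetrized derivative of the 1-form, because the fibres are Killing. *)
Definition bcv_christoffel m l p u v : 'rV[R]_3 :=
  let a := bcv_conformal m p u v 0 + l / 2 *
    (bcv_omega m l p u * v 0 1 + bcv_omega m l p v * u 0 1) in
  let b := bcv_conformal m p u v 1 - l / 2 *
    (bcv_omega m l p u * v 0 0 + bcv_omega m l p v * u 0 0) in
  let D := bcv_formD m l p in
  vec3 a b (2^-1 * (D u 0 0 * v 0 0 + D u 0 1 * v 0 1
                    + D v 0 0 * u 0 0 + D v 0 1 * u 0 1)
            - bcv_form m l p 0 0 * a - bcv_form m l p 0 1 * b).

Lemma bcv_form0 m l p : bcv_form m l p 0 0 =
  l / 2 * (p 0 1 / bcv_factor m (p 0 0) (p 0 1)).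
Proof. by rewrite mxE. Qed.
Lemma bcv_form1 m l p : bcv_form m l p 0 1 =
  - (l / 2 * (p 0 0 / bcv_factor m (p 0 0) (p 0 1))).
Proof. by rewrite mxE. Qed.
Lemma bcv_form2 m l p : bcv_form m l p 0 2 = 1.
Proof. by rewrite mxE. Qed.
Definition bcv_formE := (bcv_form0, bcv_form1, bcv_form2).

Lemma horizontal_deltaE :
  (horizontal_delta 0 0 = 1) * (horizontal_delta 1 1 = 1) *
  (horizontal_delta 0 1 = 0) * (horizontal_delta 1 0 = 0) *
  (horizontal_delta 0 2 = 0) * (horizontal_delta 2 0 = 0) *
  (horizontal_delta 1 2 = 0) * (horizontal_delta 2 1 = 0) *
  (horizontal_delta 2 2 = 0).
Proof.
rewrite /horizontal_delta; do ?split;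
by rewrite ?eqxx /= ?(mulr0,mul0r,mulr1,addr0,add0r).
Qed.

Lemma delta3E : (((delta_mx 0 0 : 'rV[R]_3) = vec3 1 0 0) *
  ((delta_mx 0 1 : 'rV[R]_3) = vec3 0 1 0) *
  ((delta_mx 0 2 : 'rV[R]_3) = vec3 0 0 1))%type.
Proof. by do ?split; apply/rowP; apply: ord3_ind; rewrite vec3E mxE. Qed.

Lemma bcv_metric_sym m l p : (bcv_metric m l p)^T = bcv_metric m l p.
Proof.
apply/matrixP => i j; rewrite mxE !bcv_metricE /horizontal_delta; ring.
Qed.

Lemma bcv_metric_unit m l p : bcv_factor m (p 0 0) (p 0 1) != 0 ->
  bcv_metric m l p \in unitmx.
Proof.
move=> F0; set F := bcv_factor _ _ _ in F0.
set P := bcv_form m l p 0 0; set Q := bcv_form m l p 0 1.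
(* The inverse metric is the sum of the squares of an orthonormal frame: the horizontal lifts of F
   d/dx and F d/dy, and d/dz. *)
pose B := \matrix_(i < 3, j < 3)
  (vec3 F 0 (- F * P) 0 i * vec3 F 0 (- F * P) 0 j +
   vec3 0 F (- F * Q) 0 i * vec3 0 F (- F * Q) 0 j +
   vec3 0 0 1 0 i * vec3 0 0 1 0 j).
suff /mulmx1_unit[//] : bcv_metric m l p *m B = 1%:M.
apply/matrixP => i j; rewrite mxE sum3 !bcv_metricE -/F.
move: i; apply: ord3_ind; move: j; apply: ord3_ind;
rewrite !horizontal_deltaE -/P -/Q ?bcv_form2 ![B _ _]mxE !vec3E mxE /=; by field.
Qed.

Lemma bcv_christoffel_formE m l p u v : bcv_factor m (p 0 0) (p 0 1) != 0 ->
  christoffel_form (bcv_metric m l) p u v = bcv_christoffel m l p u v.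
Proof.
move=> F0; apply: (@christoffel_formP _ _ _ (fun r => bcv_metricD m l p (delta_mx 0 r))).
- exact: bcv_metric_unit.
- exact: bcv_metric_sym.
- by move=> r i j; apply: is_derive_bcv_metric.
move=> r; rewrite mxE !sum3 !bcv_metricE; move: r; apply: ord3_ind;
rewrite !delta3E ![bcv_metricD _ _ _ _ _ _]mxE !horizontal_deltaE;
rewrite /bcv_christoffel /bcv_formD /bcv_conformal /bcv_omega !bcv_formE !vec3E /=;
move: (p 0 0) (p 0 1) F0 => x y; rewrite /bcv_factor => F0; by field.
Qed.

End bcv_connection.

(** * Curvature *)

Lemma christoffel_form0 (R : realType) (n : nat) (g : metric R n)
    (p w : 'rV[R]_n) : christoffel_form g p 0 w = 0.
Proof.
apply/rowP => k; rewrite !mxE big1 // => i _; rewrite big1 // => j _.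
by rewrite mxE mulr0 mul0r.
Qed.

Lemma nablaE (R : realType) (n : nat) (g : metric R n)
    (X Y : 'rV[R]_n -> 'rV[R]_n) p :
  nabla g X Y p = 'D_(X p) Y p + christoffel_form g p (X p) (Y p).
Proof. by rewrite /nabla /nabla_along derive_id. Qed.

(** Constant fields commute, and the covariant derivative of a constant field is the Christoffel
    form alone. *)
Lemma curvature_atE (R : realType) (n : nat) (g : metric R n)
    (p u v w : 'rV[R]_n) :
  curvature_at g p u v w =
    'D_u (fun q => christoffel_form g q v w) p
    - 'D_v (fun q => christoffel_form g q u w) p
    + christoffel_form g p u (christoffel_form g p v w)
    - christoffel_form g p v (christoffel_form g p u w).
Proof.
have N x z : nabla g (cst x) (cst z) = fun q => christoffel_form g q x z.
  by apply/funext => q; rewrite nablaE derive_cst add0r.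
rewrite /curvature_at /curvature !N !nablaE /lie_bracket !derive_cst subr0.
rewrite christoffel_form0 addr0 subr0 opprD !addrA; congr (_ - _).
exact: addrAC.
Qed.

(** In the last sum of the 3-tension the normal vector is the second argument of the curvature,
    whereas [hopf_curvature] expects it first. *)
Lemma curvature_at_antisym (R : realType) (n : nat) (g : metric R n)
    (p u v w : 'rV[R]_n) :
  curvature_at g p v u w = - curvature_at g p u v w.
Proof.
rewrite !curvature_atE !opprD !opprK (addrC (- _)) -!addrA; congr (_ + (_ + _)).
exact: addrC.
Qed.

Section bcv_curvature.
Context {R : realType}.
Implicit Types (p q u v w d : 'rV[R]_3) (m l x y a b c : R).

Definition bcv_conformalD m p d u v (j : 'I_3) : R :=
  let x := p 0 0 in let y := p 0 1 in
  let lam := (bcv_factor m x y)^-1 in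
  let dlam := - 2 * m * lam ^+ 2 * (x * d 0 0 + y * d 0 1) in
  - 2 * m * (dlam *
  ((x * u 0 0 + y * u 0 1) * v 0 j + (x * v 0 0 + y * v 0 1) * u 0 j
   - (u 0 0 * v 0 0 + u 0 1 * v 0 1) * p 0 j) + lam *
  ((d 0 0 * u 0 0 + d 0 1 * u 0 1) * v 0 j + (d 0 0 * v 0 0 + d 0 1 * v 0 1) * u 0 j
   - (u 0 0 * v 0 0 + u 0 1 * v 0 1) * d 0 j)).

Definition bcv_formDD m l p d u : 'rV[R]_3 :=
  let x := p 0 0 in let y := p 0 1 in
  let lam := (bcv_factor m x y)^-1 in
  let D v := - 2 * m * lam ^+ 2 * (x * v 0 0 + y * v 0 1) in
  let DD := - 2 * m * (2 * lam * D d * (x * u 0 0 + y * u 0 1)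
                      + lam ^+ 2 * (d 0 0 * u 0 0 + d 0 1 * u 0 1)) in
  vec3 (l / 2 * (u 0 1 * D d + d 0 1 * D u + y * DD))
       (- (l / 2 * (u 0 0 * D d + d 0 0 * D u + x * DD))) 0.

Definition bcv_christoffelD m l p d u v : 'rV[R]_3 :=
  let om w := bcv_omega m l p w in
  let D := bcv_formD m l p in
  let omD w := D d 0 0 * w 0 0 + D d 0 1 * w 0 1 in
  let a := bcv_conformal m p u v 0 + l / 2 * (om u * v 0 1 + om v * u 0 1) in
  let b := bcv_conformal m p u v 1 - l / 2 * (om u * v 0 0 + om v * u 0 0) in
  let a' := bcv_conformalD m p d u v 0 + l / 2 * (omD u * v 0 1 + omD v * u 0 1) in
  let b' := bcv_conformalD m p d u v 1 - l / 2 * (omD u * v 0 0 + omD v * u 0 0) in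
  let DD := bcv_formDD m l p d in
  vec3 a' b' (2^-1 * (DD u 0 0 * v 0 0 + DD u 0 1 * v 0 1
                    + DD v 0 0 * u 0 0 + DD v 0 1 * u 0 1)
            - D d 0 0 * a - bcv_form m l p 0 0 * a'
            - D d 0 1 * b - bcv_form m l p 0 1 * b').

Lemma is_derive_bcv_conformal m p d u v j : bcv_factor m (p 0 0) (p 0 1) != 0 ->
  is_derive p d (fun q => bcv_conformal m q u v j) (bcv_conformalD m p d u v j).
Proof.
move=> F0; have d0 := is_derive_coord p d 0; have d1 := is_derive_coord p d 1.
have dj := is_derive_coord p d j; have dl := is_derive_bcv_factor_inv d F0.
rewrite /bcv_conformal; is_derive_tac; rewrite /bcv_conformalD; ring.
Qed.

Lemma is_derive_bcv_formD m l p d u j : bcv_factor m (p 0 0) (p 0 1) != 0 ->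
  is_derive p d (fun q => bcv_formD m l q u 0 j) (bcv_formDD m l p d u 0 j).
Proof.
move=> F0; have d0 := is_derive_coord p d 0; have d1 := is_derive_coord p d 1.
have dl := is_derive_bcv_factor_inv d F0.
rewrite /bcv_formD /bcv_formDD; move: j; apply: ord3_ind; rewrite vec3E;
  under eq_fun do rewrite vec3E.
- by is_derive_tac; ring.
- by is_derive_tac; ring.
- exact: is_derive_fun_cst.
Qed.

Lemma is_derive_bcv_christoffel m l p d u v : bcv_factor m (p 0 0) (p 0 1) != 0 ->
  is_derive p d (fun q => bcv_christoffel m l q u v)
    (bcv_christoffelD m l p d u v).
Proof.
move=> F0.
have c0 := is_derive_bcv_conformal d u v 0 F0.
have c1 := is_derive_bcv_conformal d u v 1 F0.
have f0 := is_derive_bcv_form l d 0 F0; have f1 := is_derive_bcv_form l d 1 F0.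
have u0 := is_derive_bcv_formD l d u 0 F0; have u1 := is_derive_bcv_formD l d u 1 F0.
have v0 := is_derive_bcv_formD l d v 0 F0; have v1 := is_derive_bcv_formD l d v 1 F0.
apply: is_derive_row; rewrite /bcv_christoffel /bcv_christoffelD /bcv_omega.
apply: ord3_ind; rewrite vec3E; under eq_fun do rewrite vec3E.
- by is_derive_tac; ring.
- by is_derive_tac; ring.
- by is_derive_tac; ring.
Qed.

(** The closed form of the Christoffel form is established where the factor is nonzero; to
    differentiate it at [p], it must hold on a neighbourhood. *)
Lemma near_bcv_factor_gt0 m p : 0 < bcv_factor m (p 0 0) (p 0 1) ->
  \forall q \near p, 0 < bcv_factor m ((q : 'rV[R]_3) 0 0) (q 0 1).
Proof.
move=> Fp; have cF : (fun q : 'rV[R]_3 => 1 + m * (q 0 0 * q 0 0 + q 0 1 * q 0 1)) @ p -->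
    1 + m * (p 0 0 * p 0 0 + p 0 1 * p 0 1).
  have c j : (fun q : 'rV[R]_3 => q 0 j) @ p --> p 0 j by exact: coord_continuous.
  exact: cvgD (cvg_cst _) (cvgM (cvg_cst _)
    (cvgD (cvgM (c 0) (c 0)) (cvgM (c 1) (c 1)))).
exact: (cvgr_gt _ cF).
Qed.

Lemma bcv_curvature_atE m l p u v w : 0 < bcv_factor m (p 0 0) (p 0 1) ->
  curvature_at (bcv_metric m l) p u v w =
  bcv_christoffelD m l p u v w - bcv_christoffelD m l p v u w
  + bcv_christoffel m l p u (bcv_christoffel m l p v w)
  - bcv_christoffel m l p v (bcv_christoffel m l p u w).
Proof.
move=> Fp; have F0 := lt0r_neq0 Fp.
rewrite curvature_atE !bcv_christoffel_formE //.
have D d e z : 'D_d (fun q => christoffel_form (bcv_metric m l) q e z) p =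
    bcv_christoffelD m l p d e z.
  rewrite -(@derive_val _ _ _ _ _ _ _ (is_derive_bcv_christoffel l d e z F0)).
  apply: near_eq_derive => //; near=> q.
  apply: bcv_christoffel_formE; apply: lt0r_neq0; near: q.
  exact: near_bcv_factor_gt0.
by rewrite !D.
Unshelve. all: by end_near.
Qed.

End bcv_curvature.

(** * Curvature in terms of the base components and the vertical 1-form *)

Section bcv_lift.
Context {R : realType}.
Implicit Types (p q u v w d : 'rV[R]_3) (m l x y a b c : R).

(* The vector over (a, b) on which the vertical 1-form takes the value c. *)
Definition bcv_lift m l p a b c : 'rV[R]_3 :=
  vec3 a b (c - bcv_form m l p 0 0 * a - bcv_form m l p 0 1 * b).

Lemma bcv_lift0 m l p a b c : bcv_lift m l p a b c 0 0 = a.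
Proof. by rewrite vec3E. Qed.
Lemma bcv_lift1 m l p a b c : bcv_lift m l p a b c 0 1 = b.
Proof. by rewrite vec3E. Qed.
Lemma bcv_omega_lift m l p a b c : bcv_omega m l p (bcv_lift m l p a b c) = c.
Proof. by rewrite /bcv_omega !vec3E; ring. Qed.
Definition bcv_liftE := (bcv_lift0, bcv_lift1, bcv_omega_lift).

(** The base components and the value of the vertical 1-form are linear coordinates on the tangent
    space, so the linear rules below are checked on them. *)
Lemma bcv_lift_eq m l p u a b c : u 0 0 = a -> u 0 1 = b -> bcv_omega m l p u = c ->
  u = bcv_lift m l p a b c.
Proof.
move=> <- <- <-; apply/rowP; apply: ord3_ind; rewrite vec3E //.
rewrite /bcv_omega; ring.
Qed.

Lemma bcv_omegaD m l p : {morph bcv_omega m l p : u v / u + v}.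
Proof. by move=> u v; rewrite /bcv_omega !mxE; ring. Qed.

Lemma bcv_omegaN m l p : {morph bcv_omega m l p : u / - u}.
Proof. by move=> u; rewrite /bcv_omega !mxE; ring. Qed.

Lemma bcv_lift_add m l p a b c a' b' c' :
  bcv_lift m l p a b c + bcv_lift m l p a' b' c' =
  bcv_lift m l p (a + a') (b + b') (c + c').
Proof.
by apply: bcv_lift_eq; rewrite ?bcv_omegaD ?[(_ + _ : 'rV__) _ _]mxE ?bcv_liftE.
Qed.

Lemma bcv_lift_opp m l p a b c :
  - bcv_lift m l p a b c = bcv_lift m l p (- a) (- b) (- c).
Proof.
by apply: bcv_lift_eq; rewrite ?bcv_omegaN ?[(- _ : 'rV__) _ _]mxE ?bcv_liftE.
Qed.

Lemma bcv_lift_scale m l p k a b c :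
  k *: bcv_lift m l p a b c = bcv_lift m l p (k * a) (k * b) (k * c).
Proof.
apply: bcv_lift_eq; rewrite ?/bcv_omega ![(_ *: _ : 'rV__) _ _]mxE ?bcv_liftE //.
rewrite -[in RHS](bcv_omega_lift m l p a b c) /bcv_omega !bcv_liftE; ring.
Qed.

Section lift_derivatives.
Variables (m l : R) (p : 'rV[R]_3).
Let x := p 0 0.
Let y := p 0 1.
Let lam := (bcv_factor m x y)^-1.
Let L := bcv_lift m l p.

(** In the vertical argument, the terms of [bcv_formD] that do not differentiate [lam] are
    antisymmetric in the two vectors and cancel; this is where the factor [m] comes from. *)
Lemma bcv_christoffel_lift a b c a' b' c' :
  bcv_christoffel m l p (L a b c) (L a' b' c') =
  L (- 2 * m * lam * (x * (a * a' - b * b') + y * (b * a' + a * b'))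
     + l / 2 * (c * b' + c' * b))
    (- 2 * m * lam * (y * (b * b' - a * a') + x * (b * a' + a * b'))
     - l / 2 * (c * a' + c' * a))
    (m * l / 2 * lam ^+ 2 * ((x ^+ 2 - y ^+ 2) * (a * b' + b * a')
                        + 2 * x * y * (b * b' - a * a'))).
Proof.
rewrite /L /bcv_christoffel /bcv_conformal !bcv_liftE -/x -/y -/lam.
rewrite /bcv_lift; congr vec3.
- ring.
- ring.
- by rewrite /bcv_formD !vec3E -/x -/y -/lam; field.
Qed.

(** [om] is the derivative of the vertical 1-form along the first vector. The vertical argument ends
    with [- om] of the base part because the 1-form of a derivative is the derivative of the 1-form
    minus this term. *)
Lemma bcv_christoffelD_lift (d e f a b c a' b' c' : R) :
  let dlam := - 2 * m * lam ^+ 2 * (x * d + y * e) in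
  let om a b := l / 2 * ((e * lam + y * dlam) * a - (d * lam + x * dlam) * b) in
  let quad x y := 2^-1 * ((x ^+ 2 - y ^+ 2) * (a * b' + b * a')
                        + 2 * x * y * (b * b' - a * a')) in
  bcv_christoffelD m l p (L d e f) (L a b c) (L a' b' c') =
  L (- 2 * m * (dlam * (x * (a * a' - b * b') + y * (b * a' + a * b'))
                + lam * (d * (a * a' - b * b') + e * (b * a' + a * b')))
     + l / 2 * (om a b * b' + om a' b' * b))
    (- 2 * m * (dlam * (y * (b * b' - a * a') + x * (b * a' + a * b'))
                + lam * (e * (b * b' - a * a') + d * (b * a' + a * b')))
     - l / 2 * (om a b * a' + om a' b' * a))
    (m * l * (2 * lam * dlam * quad x y
      + lam ^+ 2 * ((x * d - y * e) * (a * b' + b * a') +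
                    (x * e + y * d) * (b * b' - a * a')))
     - om (- 2 * m * lam * (x * (a * a' - b * b') + y * (b * a' + a * b'))
     + l / 2 * (c * b' + c' * b))
    (- 2 * m * lam * (y * (b * b' - a * a') + x * (b * a' + a * b'))
     - l / 2 * (c * a' + c' * a))).
Proof.
move=> dlam om quad.
rewrite /L /bcv_christoffelD /bcv_conformal /bcv_conformalD !bcv_liftE -/x -/y -/lam.
rewrite /bcv_formD /bcv_formDD !vec3E ?bcv_liftE -/x -/y -/lam -/dlam.
rewrite /om /bcv_lift; congr vec3.
- ring.
- ring.
- rewrite /quad /dlam; by field.
Qed.

(** The constants are those of O'Neill's formulas: the curvature 4 m of the base drops by 3 (l/2)^2
    on horizontal planes, and planes containing the fibre have curvature (l/2)^2. The length of (a,
    b) is kept general, so that the only relation involved is the definition of [lam]. *)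
Lemma bcv_curvature_lift a b nu al al' de de' :
  0 < bcv_factor m x y ->
  let k := nu * ((4 * m - 3 / 4 * l ^+ 2) * al * al' * (a ^+ 2 + b ^+ 2)
    * lam ^+ 2 + l ^+ 2 / 4 * de * de') in
  curvature_at (bcv_metric m l) p (L (- nu * b) (nu * a) 0)
    (L (al * a) (al * b) de) (L (al' * a) (al' * b) de') =
  L (- k * b) (k * a) 0.
Proof.
move=> Fp k; rewrite bcv_curvature_atE //; have F0 := lt0r_neq0 Fp.
(* This is [lam] times the factor equal to 1, solved for one monomial so that [field] can use it
   once [lam] is generalized. *)
have lamE : lam * m * x ^+ 2 = 1 - lam - lam * m * y ^+ 2.
  by rewrite /lam /bcv_factor; field.
rewrite !bcv_christoffel_lift !bcv_christoffelD_lift.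
rewrite !bcv_lift_opp !bcv_lift_add.
move: x y lam lamE @k {F0 Fp} => x' y' lam' lamE' k.
by congr bcv_lift; rewrite /k {k}; field: lamE'.
Qed.
End lift_derivatives.
End bcv_lift.

(** * Curves parametrized by arc length *)

Lemma is_derive_comp_coord (R : realType) n (f : R -> R) (q u : 'rV[R]_n) j df :
  is_derive (q 0 j) 1 f df -> is_derive q u (fun p => f (p 0 j)) (df * u 0 j).
Proof.
move=> [/derivable1_diffP fd fdE].
have cd : differentiable (fun p : 'rV[R]_n => p 0 j) q.
  exact: differentiable_coord.
have fcd : differentiable (f \o (fun p : 'rV[R]_n => p 0 j)) q.
  exact: differentiable_comp.
split; first exact: diff_derivable.
rewrite (deriveE u fcd) (diff_comp cd fd) /=.
rewrite -[X in 'd f _ X](deriveE u cd).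
rewrite (@derive_val _ _ _ _ _ _ _ (is_derive_coord q u j)).
by rewrite -[X in 'd f _ X]mulr1 [LHS]linearZ /= -deriveE // fdE mulrC.
Qed.

Lemma near_open (T : topologicalType) (A : set T) (P : T -> Prop) p :
  open A -> A p -> (forall q, A q -> P q) -> \forall q \near p, P q.
Proof.
move=> oA Ap AP; have : nbhs p A by exact: open_nbhs_nbhs.
exact: filterS.
Qed.

Lemma is_derive_open_eq (R : realType) (V W : normedModType R) (A : set V)
    (f g : V -> W) p v df :
  open A -> A p -> (forall q, A q -> f q = g q) ->
  is_derive p v f df -> is_derive p v g df.
Proof. by move=> oA Ap fg; apply: near_eq_is_derive; exact: near_open fg. Qed.

Lemma is_derive_unique (R : realType) (V W : normedModType R) (f : V -> W)
  p v d1 d2 : is_derive p v f d1 -> is_derive p v f d2 -> d1 = d2.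
Proof. by move=> [_ <-] [_ <-]. Qed.

Section arclength_curve.
Context {R : realType} (m l : R) (I : set R) (gamma : R -> 'rV[R]_2).
Hypotheses (oI : open I) (gammaP : arclength_curve m I gamma).

Definition curve_jet (j : nat) (s : R) (i : 'I_2) : R := derive1n j gamma s 0 i.
Local Notation X j := (fun s => curve_jet j s 0).
Local Notation Y j := (fun s => curve_jet j s 1).

Definition curve_factor s := bcv_factor m (X 0 s) (Y 0 s).

(** The geodesic curvature (see [geodesic_curvatureE]) expanded for differentiation. The second term
    is minus the derivative of the logarithm of the conformal factor along the unit normal. *)
Definition curvature_fun s : R :=
  (curve_factor s)^-1 ^+ 2 * (X 1 s * Y 2 s - Y 1 s * X 2 s)
  + 2 * m * (curve_factor s)^-1 * (Y 0 s * X 1 s - X 0 s * Y 1 s).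

Lemma is_derive_curve_jet j s i : I s ->
  is_derive s 1 (fun s => curve_jet j s i) (curve_jet j.+1 s i).
Proof.
case: gammaP => [gd _ _] Is; apply: is_derive_row_entry.
by rewrite derive1nS derive1E; apply: derivableP; exact: gd.
Qed.

Lemma curve_factor_gt0 s : I s -> 0 < curve_factor s.
Proof. by case: gammaP => [_ + _] => /[apply]. Qed.

Lemma curve_factor_neq0 s : I s -> curve_factor s != 0.
Proof. by move=> Is; rewrite lt0r_neq0 // curve_factor_gt0. Qed.

Lemma curve_speed s : I s -> X 1 s ^+ 2 = curve_factor s ^+ 2 - Y 1 s ^+ 2.
Proof.
move=> Is; have F0 := curve_factor_neq0 Is.
case: gammaP => [_ _ /(_ _ Is)].
rewrite /inner /base_metric mul_mx_scalar -scalemxAl mxE mxE.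
rewrite big_ord_recl big_ord1 !mxE -/(curve_factor s).
rewrite (_ : lift ord0 ord0 = 1); last exact: val_inj.
rewrite -/(curve_jet 1 s 0) -/(curve_jet 1 s 1) => H.
have -> : curve_factor s ^+ 2 = X 1 s * X 1 s + Y 1 s * Y 1 s.
  by rewrite -[LHS]mulr1 -H; field.
ring.
Qed.

Lemma is_derive_curve_factor s : I s ->
  is_derive s 1 curve_factor (2 * m * (X 0 s * X 1 s + Y 0 s * Y 1 s)).
Proof.
move=> Is; have dX := is_derive_curve_jet 0 0 Is.
have dY := is_derive_curve_jet 0 1 Is.
by rewrite /curve_factor /bcv_factor; is_derive_tac; ring.
Qed.

Lemma is_derive_curve_factor_inv s : I s ->
  is_derive s 1 (fun s => (curve_factor s)^-1)
    (- 2 * m * (curve_factor s)^-1 ^+ 2 * (X 0 s * X 1 s + Y 0 s * Y 1 s)).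
Proof.
move=> Is; have dF := is_derive_curve_factor Is.
notypeclasses refine (is_derive_eq (is_derive_fun_inv (curve_factor_neq0 Is) dF) _).
rewrite exprVn; ring.
Qed.

(** Differentiating the unit speed relation gives the tangential part of the acceleration;
    [curvature_fun] carries the normal part. *)
Lemma curve_speedD s : I s ->
  X 1 s * X 2 s + Y 1 s * Y 2 s =
  2 * m * curve_factor s * (X 0 s * X 1 s + Y 0 s * Y 1 s).
Proof.
move=> Is; have dX := is_derive_curve_jet 1 0 Is.
have dY := is_derive_curve_jet 1 1 Is; have dF := is_derive_curve_factor Is.
pose f s := X 1 s ^+ 2 + Y 1 s ^+ 2 - curve_factor s ^+ 2.
have d1 : is_derive s 1 f (2 * (X 1 s * X 2 s + Y 1 s * Y 2 s) -
    2 * (2 * m * curve_factor s * (X 0 s * X 1 s + Y 0 s * Y 1 s))).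
  by rewrite /f; is_derive_tac; ring.
have d0 : is_derive s 1 f 0.
  apply: (is_derive_open_eq (f := fun _ => 0) oI Is) (is_derive_fun_cst _ _ _).
  by move=> t It; rewrite /f curve_speed //; ring.
have /eqP := is_derive_unique d1 d0.
by rewrite -mulrBr mulf_eq0 pnatr_eq0 /= subr_eq0 => /eqP.
Qed.

(* The Frenet equation, with the Christoffel terms of the conformal metric moved
   to the right-hand side. *)
Lemma curve_accel s : I s ->
  let F := curve_factor s in let k := curvature_fun s in
  let g := X 0 s * X 1 s + Y 0 s * Y 1 s in
  (X 2 s = - k * Y 1 s + 4 * m / F * g * X 1 s - 2 * m * F * X 0 s) /\
  (Y 2 s = k * X 1 s + 4 * m / F * g * Y 1 s - 2 * m * F * Y 0 s).
Proof.
move=> Is F k g; have F0 := curve_factor_neq0 Is.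
have v1 := curve_speed Is; have v2 := curve_speedD Is.
rewrite /k /curvature_fun /g -/F in F0 v1 v2 *.
(* The same two relations are solved for different monomials, as each component of the acceleration
   needs its own elimination. *)
have v1' : Y 1 s ^+ 2 = F ^+ 2 - X 1 s ^+ 2 by rewrite v1; ring.
have v2X : X 1 s * X 2 s = 2 * m * F * (X 0 s * X 1 s + Y 0 s * Y 1 s) - Y 1 s * Y 2 s.
  by rewrite -v2; ring.
have v2Y : Y 1 s * Y 2 s = 2 * m * F * (X 0 s * X 1 s + Y 0 s * Y 1 s) - X 1 s * X 2 s.
  by rewrite -v2; ring.
move: (X 0 s) (X 1 s) (X 2 s) (Y 0 s) (Y 1 s) (Y 2 s) F F0 v1 v1' v2 v2X v2Y {k g}.
move=> x x1 x2 y y1 y2 F F0 v1 v1' v2 v2X v2Y.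
split.
  by field: v1' v2Y.
by field: v1 v2X.
Qed.

Lemma is_derive_curvature_fun s : I s -> exists k', is_derive s 1 curvature_fun k'.
Proof.
move=> Is; have dX j := is_derive_curve_jet j 0 Is.
have dY j := is_derive_curve_jet j 1 Is; have dF := is_derive_curve_factor_inv Is.
have dX0 := dX 0; have dX1 := dX 1%N; have dX2 := dX 2%N.
have dY0 := dY 0; have dY1 := dY 1%N; have dY2 := dY 2%N.
by eexists; rewrite /curvature_fun; repeat is_derive_step.
Qed.

End arclength_curve.

Lemma ord2_ind (P : 'I_2 -> Prop) : P 0 -> P 1 -> forall i, P i.
Proof.
move=> P0 P1 [[|[|//]] Hi].
- by rewrite (_ : Ordinal Hi = 0) //; apply: val_inj.
- by rewrite (_ : Ordinal Hi = 1) //; apply: val_inj.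
Qed.

Lemma sum2 (V : nmodType) (f : 'I_2 -> V) : \sum_(i < 2) f i = f 0 + f 1.
Proof.
by rewrite big_ord_recl big_ord1; congr (f _ + f _); apply: val_inj.
Qed.

Lemma delta2E (R : realType) :
  (((delta_mx 0 0 : 'rV[R]_2) 0 0 = 1) * ((delta_mx 0 0 : 'rV[R]_2) 0 1 = 0) *
   ((delta_mx 0 1 : 'rV[R]_2) 0 0 = 0) * ((delta_mx 0 1 : 'rV[R]_2) 0 1 = 1))%type.
Proof. by do ?split; rewrite mxE. Qed.

(** * The base surface and the geodesic curvature *)

Section base_connection.
Context {R : realType} (m : R).
Implicit Types (p u v : 'rV[R]_2).

Lemma base_inner p u v : inner (base_metric m p) u v =
  bcv_factor m (p 0 0) (p 0 1) ^- 2 * (u 0 0 * v 0 0 + u 0 1 * v 0 1).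
Proof.
by rewrite /inner /base_metric mul_mx_scalar -scalemxAl mxE mxE sum2 !mxE.
Qed.

Lemma base_christoffel_formE p u v : bcv_factor m (p 0 0) (p 0 1) != 0 ->
  christoffel_form (base_metric m) p u v =
  \row_j (- 2 * m / bcv_factor m (p 0 0) (p 0 1) *
    ((p 0 0 * u 0 0 + p 0 1 * u 0 1) * v 0 j
     + (p 0 0 * v 0 0 + p 0 1 * v 0 1) * u 0 j
     - (u 0 0 * v 0 0 + u 0 1 * v 0 1) * p 0 j)).
Proof.
move=> F0; set F := bcv_factor _ _ _ in F0 *.
pose dg r : 'M[R]_2 := (- 4 * m * F^-1 ^+ 3 * p 0 r)%:M.
apply: (@christoffel_formP _ _ _ dg).
- suff /mulmx1_unit[//] : base_metric m p *m (F ^+ 2)%:M = 1%:M.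
  by rewrite /base_metric mul_mx_scalar scale_scalar_mx mulfV // expf_neq0.
- by rewrite /base_metric tr_scalar_mx.
- move=> r i j; have d0 := is_derive_coord p (delta_mx 0 r) 0.
  have d1 := is_derive_coord p (delta_mx 0 r) 1.
  pose f (q : 'rV[R]_2) := bcv_factor m (q 0 0) (q 0 1).
  have df : is_derive p (delta_mx 0 r) f (2 * m * p 0 r).
    rewrite /f /bcv_factor; is_derive_tac.
    by move: r {dg d0 d1}; apply: ord2_ind; rewrite !delta2E; ring.
  have E : (fun q => base_metric m q i j) = fun q => (i == j)%:R * (f q)^-1 ^+ 2.
    by apply/funext => q; rewrite /base_metric /= mxE -exprVn mulr_natl.
  rewrite E /dg mxE.
  have dif := @is_derive_fun_inv _ _ _ _ f _ F0 df.
  by is_derive_tac; rewrite /f -/F; field.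
- move=> r; rewrite /base_metric mul_mx_scalar !mxE !sum2 /dg !mxE -/F.
  by move: r; apply: ord2_ind; rewrite /= ?(mulr1n, mulr0n); field.
Qed.

End base_connection.

Section geodesic_curvature.
Context {R : realType} (m l : R) (I : set R) (gamma : R -> 'rV[R]_2).
Hypotheses (oI : open I) (gammaP : arclength_curve m I gamma).

Lemma geodesic_curvatureE s : I s ->
  geodesic_curvature m gamma s = curvature_fun m gamma s.
Proof.
move=> Is; have F0 := curve_factor_neq0 gammaP Is.
have v1 := curve_speed gammaP Is.
rewrite /geodesic_curvature /nabla_along base_inner base_christoffel_formE //.
rewrite -!derive1E -(derive1nS gamma 1) /rot90 !mxE /=.
rewrite /curvature_fun -/(curve_factor m gamma s).
rewrite -/(curve_jet gamma 1 s 0) -/(curve_jet gamma 1 s 1).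
rewrite -/(curve_jet gamma 2 s 0) -/(curve_jet gamma 2 s 1).
rewrite -/(curve_jet gamma 0 s 0) -/(curve_jet gamma 0 s 1).
by field: v1.
Qed.
End geodesic_curvature.

(** * Hopf cylinders *)

Section hopf_frame.
Context {R : realType} (m l : R) (I : set R) (gamma : R -> 'rV[R]_2).
Hypotheses (oI : open I) (gammaP : arclength_curve m I gamma).
Local Notation X j s := (curve_jet gamma j s 0).
Local Notation Y j s := (curve_jet gamma j s 1).
Local Notation F s := (curve_factor m gamma s).
Local Notation kappa := (curvature_fun m gamma).
Local Notation phi := (hopf_cylinder gamma).
Local Notation g := (bcv_metric m l).
Implicit Types (q u v : 'rV[R]_2) (s : R).

(** The vertical 1-form pulls back to the cylinder as theta = dt + conn ds; [hopf_theta] is its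
    value on a tangent vector. *)
Definition curve_conn s : R := l / 2 * (F s)^-1 * (Y 0 s * X 1 s - X 0 s * Y 1 s).

Definition hopf_theta q u : R := u 0 1 + curve_conn (q 0 0) * u 0 0.

(* The vector with components (a, b, c) in the orthonormal frame made of the
   horizontal lifts of the unit tangent and unit normal of [gamma], and of the
   unit vertical field. *)
Definition hopf_vec q (a b c : R) : 'rV[R]_3 :=
  bcv_lift m l (phi q) (a * X 1 (q 0 0) - b * Y 1 (q 0 0))
                       (a * Y 1 (q 0 0) + b * X 1 (q 0 0)) c.

Lemma hopf_cylinderE q : phi q = vec3 (X 0 (q 0 0)) (Y 0 (q 0 0)) (q 0 1).
Proof. by rewrite unlock. Qed.

Lemma hopf_form0 q : bcv_form m l (phi q) 0 0 = l / 2 * (Y 0 (q 0 0) * (F (q 0 0))^-1).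
Proof. by rewrite bcv_form0 hopf_cylinderE !vec3E. Qed.

Lemma hopf_form1 q : bcv_form m l (phi q) 0 1 =
  - (l / 2 * (X 0 (q 0 0) * (F (q 0 0))^-1)).
Proof. by rewrite bcv_form1 hopf_cylinderE !vec3E. Qed.

Lemma hopf_factor q : bcv_factor m (phi q 0 0) (phi q 0 1) = F (q 0 0).
Proof. by rewrite hopf_cylinderE !vec3E. Qed.

Lemma is_derive_hopf_cylinder q u : I (q 0 0) ->
  is_derive q u phi (hopf_vec q (u 0 0) 0 (hopf_theta q u)).
Proof.
move=> Iq; apply: is_derive_row; apply: ord3_ind; rewrite /hopf_vec /bcv_lift vec3E;
  under eq_fun do rewrite hopf_cylinderE vec3E.
- apply: is_derive_eq (is_derive_comp_coord _ (is_derive_curve_jet gammaP 0 0 Iq)) _.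
  ring.
- apply: is_derive_eq (is_derive_comp_coord _ (is_derive_curve_jet gammaP 0 1 Iq)) _.
  ring.
- apply: is_derive_eq (is_derive_coord _ _ _) _.
  rewrite hopf_form0 hopf_form1 /hopf_theta /curve_conn; ring.
Qed.

(** The connection matrix of the frame (T, N, xi) is skew: [rho] rotates the pair (T, N),
    [l / 2 * u 0 0] rotates the pair (N, xi), and T and xi are not coupled, which is why they are
    parallel on the cylinder. *)
Lemma nabla_hopf (al be de : 'rV[R]_2 -> R) q u (dal dbe dde : R) :
  I (q 0 0) -> is_derive q u al dal -> is_derive q u be dbe -> is_derive q u de dde ->
  let rho := kappa (q 0 0) * u 0 0 - l / 2 * hopf_theta q u in
  nabla_along g phi (fun p => hopf_vec p (al p) (be p) (de p)) q u =
  hopf_vec q (dal - be q * rho)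
             (dbe + al q * rho - l / 2 * u 0 0 * de q)
             (dde + l / 2 * u 0 0 * be q).
Proof.
move=> Iq dal' dbe' dde' rho.
have F0 := curve_factor_neq0 gammaP Iq.
have dX j := is_derive_comp_coord u (is_derive_curve_jet gammaP j 0 Iq).
have dY j := is_derive_comp_coord u (is_derive_curve_jet gammaP j 1 Iq).
have dF := is_derive_comp_coord u (is_derive_curve_factor_inv gammaP Iq).
have dX0 := dX 0; have dX1 := dX 1; have dY0 := dY 0; have dY1 := dY 1.
have dV : is_derive q u (fun p => hopf_vec p (al p) (be p) (de p))
  (bcv_lift m l (phi q)
    (dal * X 1 (q 0 0) + al q * X 2 (q 0 0) * u 0 0
     - dbe * Y 1 (q 0 0) - be q * Y 2 (q 0 0) * u 0 0)
    (dal * Y 1 (q 0 0) + al q * Y 2 (q 0 0) * u 0 0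
     + dbe * X 1 (q 0 0) + be q * X 2 (q 0 0) * u 0 0)
    (dde - l / 2 * u 0 0 * (
      (Y 1 (q 0 0) * (F (q 0 0))^-1 - 2 * m * Y 0 (q 0 0) * (F (q 0 0))^-1 ^+ 2
         * (X 0 (q 0 0) * X 1 (q 0 0) + Y 0 (q 0 0) * Y 1 (q 0 0))) *
      (al q * X 1 (q 0 0) - be q * Y 1 (q 0 0))
      - (X 1 (q 0 0) * (F (q 0 0))^-1 - 2 * m * X 0 (q 0 0) * (F (q 0 0))^-1 ^+ 2
         * (X 0 (q 0 0) * X 1 (q 0 0) + Y 0 (q 0 0) * Y 1 (q 0 0))) *
      (al q * Y 1 (q 0 0) + be q * X 1 (q 0 0))))).
  apply: is_derive_row; apply: ord3_ind; rewrite /hopf_vec /bcv_lift vec3E;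
    under eq_fun do rewrite vec3E.
  - by is_derive_tac; ring.
  - by is_derive_tac; ring.
  - rewrite hopf_form0 hopf_form1; under eq_fun do rewrite hopf_form0 hopf_form1.
    by is_derive_tac; ring.
rewrite /nabla_along (@derive_val _ _ _ _ _ _ _ dV).
rewrite (@derive_val _ _ _ _ _ _ _ (is_derive_hopf_cylinder u Iq)).
rewrite bcv_christoffel_formE ?hopf_factor // /hopf_vec bcv_christoffel_lift.
rewrite hopf_factor bcv_lift_add hopf_cylinderE !vec3E -hopf_cylinderE.
(* This removes the second derivatives of the curve; unit speed and the definition of the factor
   then close the identity. *)
have [-> ->] := curve_accel oI gammaP Iq.
have v1 := curve_speed gammaP Iq.
have FE : m * X 0 (q 0 0) ^+ 2 = F (q 0 0) - 1 - m * Y 0 (q 0 0) ^+ 2.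
  by rewrite /curve_factor /bcv_factor; ring.
rewrite /rho; move: (kappa (q 0 0)) (hopf_theta q u) => k th.
move: (F (q 0 0)) (X 0 (q 0 0)) (X 1 (q 0 0)) (Y 0 (q 0 0)) (Y 1 (q 0 0)) F0 v1 FE.
move=> f x x1 y y1 F0 v1 FE {dX0 dX1 dY0 dY1 dF dV}.
by congr bcv_lift; field: v1 FE.
Qed.

End hopf_frame.

Lemma bcv_inner (R : realType) (m l : R) (p u v : 'rV[R]_3) :
  inner (bcv_metric m l p) u v =
  (bcv_factor m (p 0 0) (p 0 1))^-1 ^+ 2 * (u 0 0 * v 0 0 + u 0 1 * v 0 1)
  + bcv_omega m l p u * bcv_omega m l p v.
Proof.
rewrite /inner mxE sum3 ![(u *m _) _ _]mxE !sum3 ![_^T _ _]mxE.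
rewrite !bcv_metricE !horizontal_deltaE /bcv_omega bcv_form2; ring.
Qed.

(** The sections differentiated below have a closed form only on the domain of the frame. *)
Lemma nabla_along_eq (R : realType) n (T : normedModType R) (g : metric R n)
    (f V V' : T -> 'rV[R]_n) (A : set T) p u :
  open A -> A p -> (forall q, A q -> V q = V' q) ->
  nabla_along g f V p u = nabla_along g f V' p u.
Proof.
move=> oA Ap VV'; rewrite /nabla_along VV' //; congr (_ + _).
exact: near_eq_derive (near_open oA Ap VV').
Qed.

(** * The adapted frame and the induced metric of the cylinder *)

Section hopf_frame_fields.
Context {R : realType} (m l : R) (I : set R) (gamma : R -> 'rV[R]_2).
Hypotheses (oI : open I) (gammaP : arclength_curve m I gamma).
Local Notation X j s := (curve_jet gamma j s 0).
Local Notation Y j s := (curve_jet gamma j s 1).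
Local Notation kappa := (curvature_fun m gamma).
Local Notation conn := (curve_conn m l gamma).
Local Notation theta := (hopf_theta m l gamma).
Local Notation hvec := (hopf_vec m l gamma).
Local Notation phi := (hopf_cylinder gamma).
Local Notation g := (bcv_metric m l).
Implicit Types (q u v : 'rV[R]_2) (s a b c : R).

Lemma hopf_vec_add q a b c a' b' c' :
  hvec q a b c + hvec q a' b' c' = hvec q (a + a') (b + b') (c + c').
Proof. by rewrite /hopf_vec bcv_lift_add; congr bcv_lift; ring. Qed.

Lemma hopf_vec_opp q a b c : - hvec q a b c = hvec q (- a) (- b) (- c).
Proof. by rewrite /hopf_vec bcv_lift_opp; congr bcv_lift; ring. Qed.

Lemma hopf_vec_scale q k a b c : k *: hvec q a b c = hvec q (k * a) (k * b) (k * c).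
Proof. by rewrite /hopf_vec bcv_lift_scale; congr bcv_lift; ring. Qed.

Lemma inner_hopf_vec q a b c a' b' c' : I (q 0 0) ->
  inner (g (phi q)) (hvec q a b c) (hvec q a' b' c') = a * a' + b * b' + c * c'.
Proof.
move=> Iq; have F0 := curve_factor_neq0 gammaP Iq.
have v1 := curve_speed gammaP Iq.
rewrite bcv_inner /hopf_vec !bcv_liftE hopf_factor.
by field: v1.
Qed.

Lemma hopf_curvature q nu al al' de de' : I (q 0 0) ->
  curvature_at g (phi q) (hvec q 0 nu 0) (hvec q al 0 de) (hvec q al' 0 de') =
  hvec q 0 (nu * ((4 * m - 3 / 4 * l ^+ 2) * al * al' + l ^+ 2 / 4 * de * de')) 0.
Proof.
move=> Iq; have F0 := curve_factor_neq0 gammaP Iq.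
have v1 := curve_speed gammaP Iq.
have C := @bcv_curvature_lift _ m l (phi q) (X 1 (q 0 0)) (Y 1 (q 0 0)) nu al al' de de'.
rewrite hopf_factor /= in C.
rewrite /hopf_vec !mul0r !subr0 !addr0 !sub0r -!mulNr !add0r C; last first.
  exact: (curve_factor_gt0 gammaP Iq).
have -> : X 1 (q 0 0) ^+ 2 + Y 1 (q 0 0) ^+ 2 = curve_factor m gamma (q 0 0) ^+ 2.
  by rewrite v1; ring.
by congr bcv_lift; field.
Qed.

Lemma derive_hopf_cylinder q u : I (q 0 0) ->
  'D_u phi q = hvec q (u 0 0) 0 (theta q u).
Proof.
move=> Iq.
by rewrite (@derive_val _ _ _ _ _ _ _ (is_derive_hopf_cylinder l gammaP u Iq)).
Qed.

Lemma induced_metricE q i j : I (q 0 0) -> let e i := delta_mx 0 i in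
  induced_metric g phi q i j =
  e i 0 0 * e j 0 0 + theta q (e i) * theta q (e j).
Proof.
move=> Iq e; rewrite mxE !derive_hopf_cylinder // inner_hopf_vec //.
by rewrite mulr0 addr0.
Qed.

Lemma is_derive_curve_conn s : I s -> exists a', is_derive s 1 conn a'.
Proof.
move=> Is; have dX j := is_derive_curve_jet gammaP j 0 Is.
have dY j := is_derive_curve_jet gammaP j 1 Is.
have dF := is_derive_curve_factor_inv gammaP Is.
have dX0 := dX 0; have dX1 := dX 1%N; have dY0 := dY 0; have dY1 := dY 1%N.
by eexists; rewrite /curve_conn; repeat is_derive_step.
Qed.

Lemma open_hopf_domain : open (hopf_domain I).
Proof.
apply: (@open_comp _ _ (fun q : 'rV[R]_2 => q 0 0)) => // q _.
exact: coord_continuous.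
Qed.

Lemma induced_inner q u v : I (q 0 0) ->
  inner (induced_metric g phi q) u v = u 0 0 * v 0 0 + theta q u * theta q v.
Proof.
move=> Iq; rewrite /inner mxE sum2 ![(u *m _) _ _]mxE !sum2 ![_^T _ _]mxE.
rewrite !induced_metricE // /hopf_theta !delta2E; ring.
Qed.

(** The induced metric is ds^2 + theta^2 with theta closed, hence flat; the one surviving symbol
    only reflects that theta differs from dt. *)
Lemma induced_christoffel_formE q u v a' : I (q 0 0) ->
  is_derive (q 0 0) 1 conn a' ->
  christoffel_form (induced_metric g phi) q u v =
  (a' * u 0 0 * v 0 0) *: delta_mx 0 1.
Proof.
move=> Iq da.
pose e i : 'rV[R]_2 := delta_mx 0 i.
pose dg r : 'M[R]_2 := \matrix_(i, j)
  (a' * e r 0 0 * (e i 0 0 * theta q (e j) + theta q (e i) * e j 0 0)).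
apply: (@christoffel_formP _ _ _ dg).
(* The inverse metric again, from the orthonormal frame (0, 1), (1, - conn). *)
- pose B := \matrix_(i < 2, j < 2) (((i == 1) && (j == 1))%:R +
    (if i == 0 then 1 else - conn (q 0 0)) * (if j == 0 then 1 else - conn (q 0 0))).
  suff /mulmx1_unit[//] : induced_metric g phi q *m B = 1%:M.
  apply/matrixP => i j; rewrite mxE sum2 !induced_metricE // ![B _ _]mxE [1%:M _ _]mxE.
  rewrite /hopf_theta; move: i; apply: ord2_ind; move: j; apply: ord2_ind;
  rewrite !delta2E /=; ring.
- by apply/matrixP => i j; rewrite mxE !induced_metricE // mulrC;
    congr (_ + _); rewrite mulrC.
- move=> r i j; apply: (is_derive_open_eq open_hopf_domain Iq).
    by move=> p Ip; rewrite induced_metricE.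
  have dc := is_derive_comp_coord (delta_mx 0 r) da.
  rewrite [dg r i j]mxE /hopf_theta /e; is_derive_tac; ring.
- move=> r; rewrite mxE !sum2 !induced_metricE // ![dg _ _ _]mxE.
  rewrite ![(_ *: _ : 'rV__) _ _]mxE /e /hopf_theta.
  by move: r; apply: ord2_ind; rewrite ?delta2E /=; ring.
Qed.

End hopf_frame_fields.

(** * Tension, rough Laplacian and 3-tension in an arbitrary orthonormal frame *)

Section hopf_tritension.
Context {R : realType} (m l : R) (I : set R) (gamma : R -> 'rV[R]_2).
Hypotheses (oI : open I) (gammaP : arclength_curve m I gamma).
Local Notation kappa := (curvature_fun m gamma).
Local Notation conn := (curve_conn m l gamma).
Local Notation theta := (hopf_theta m l gamma).
Local Notation hvec := (hopf_vec m l gamma).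
Local Notation phi := (hopf_cylinder gamma).
Local Notation g := (bcv_metric m l).
Local Notation ig := (induced_metric g phi).

Context (W : set 'rV[R]_2) (E : 'I_2 -> 'rV[R]_2 -> 'rV[R]_2).
Hypothesis frameE : local_frame g phi (hopf_domain I) W E.
Implicit Types (p q u v : 'rV[R]_2).

(** [w i] and [t i] are the components of [E i] in the orthonormal coframe (ds, theta). *)
Let w i q : R := E i q 0 0.
Let t i q : R := theta q (E i q).

Let WI q : W q -> I (q 0 0). Proof. by case: frameE => + _; apply. Qed.
Let oW : open W. Proof. by case: frameE => _ []. Qed.

(** The matrix with rows (w_i, t_i) has orthonormal rows, hence orthonormal columns. The relations
    are solved for the index 0, to serve as rewriting rules for [field]. *)
Let frame_sums p : W p ->
  [/\ w 0 p ^+ 2 = 1 - w 1 p ^+ 2, w 0 p * t 0 p = - (w 1 p * t 1 p) &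
      t 0 p ^+ 2 = 1 - t 1 p ^+ 2].
Proof.
move=> Wp; case: frameE => _ [_ _ /(_ _ Wp) on].
pose M : 'M[R]_2 := \matrix_(i, j) if j == 0 then w i p else t i p.
have MMT : M *m M^T = 1%:M.
  apply/matrixP => i j; have := on i j.
  rewrite (induced_inner l gammaP _ _ (WI Wp)) mxE sum2 !mxE /= => <-.
  by [].
have /matrixP MTM : M^T *m M = 1%:M by exact: mulmx1C.
have := MTM 0 0; have := MTM 0 1; have := MTM 1 1.
rewrite !mxE !sum2 !mxE /= -/(w 0 p) -/(w 1 p) => e11 e01 e00.
have {}e00 : w 0 p * w 0 p + w 1 p * w 1 p = 1 := e00.
have {}e11 : t 0 p * t 0 p + t 1 p * t 1 p = 1 := e11.
have {}e01 : w 0 p * t 0 p + w 1 p * t 1 p = 0 := e01.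
split; [rewrite -e00; ring| |rewrite -e11; ring].
by apply/eqP; rewrite -addr_eq0 e01.
Qed.

(** As T and xi are parallel, nabla_{E_i} E_i has as components the derivatives of those of E_i. The
    trace of a second derivative thus loses all derivatives of the frame. *)
Let frame_derive i p : W p -> exists dw dt,
  [/\ is_derive p (E i p) (w i) dw, is_derive p (E i p) (t i) dt,
      nabla ig (E i) (E i) p 0 0 = dw & theta p (nabla ig (E i) (E i) p) = dt].
Proof.
move=> Wp; have Ip := WI Wp; case: frameE => _ [_ /(_ i [::] p Wp) dE _].
have {}dE : is_derive p (E i p) (E i) ('D_(E i p) (E i) p).
  by apply: derivableP; exact: diff_derivable.
have dE0 := is_derive_row_entry 0 dE; have dE1 := is_derive_row_entry 1 dE.
have [a' da] := is_derive_curve_conn l gammaP Ip.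
have dc := is_derive_comp_coord (E i p) da.
eexists; eexists; split; [exact: dE0| | |].
- rewrite /t /hopf_theta; by repeat is_derive_step.
- rewrite nablaE (induced_christoffel_formE oI gammaP _ _ Ip da) mxE.
  by rewrite [X in _ + X]mxE !delta2E mulr0 addr0.
- rewrite nablaE (induced_christoffel_formE oI gammaP _ _ Ip da) /hopf_theta !mxE /=.
  ring.
Qed.

Lemma hopf_tension p : W p -> tension g phi E p = hvec p 0 (kappa (p 0 0)) 0.
Proof.
move=> Wp; have Ip := WI Wp; have [s1 s2 s3] := frame_sums Wp.
(* The second fundamental form on (E_i, E_i); its mixed term vanishes in the sum over i. *)
have T i : nabla_along g phi (fun q => 'D_(E i q) phi q) p (E i p)
     - 'D_(nabla ig (E i) (E i) p) phi p =
   hvec p 0 (kappa (p 0 0) * w i p ^+ 2 - l * (w i p * t i p)) 0.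
  have [dw [dt [dw' dt' nw nt]]] := frame_derive i Wp.
  rewrite (nabla_along_eq _ _ _ oW Wp
    (V' := fun q => hvec q (w i q) 0 (t i q))); last first.
    by move=> q Wq; rewrite (derive_hopf_cylinder l gammaP _ (WI Wq)).
  rewrite (nabla_hopf l oI gammaP Ip dw' (is_derive_fun_cst _ _ 0) dt').
  rewrite (derive_hopf_cylinder l gammaP _ Ip) nw nt hopf_vec_opp hopf_vec_add.
  rewrite -/(w i p) -/(t i p).
  by move: (w i p) (t i p) (kappa _) => w0 t0 k; congr (hvec p _ _ _); field.
rewrite /tension (eq_bigr _ (fun i _ => T i)) sum2 hopf_vec_add; clear T.
move: (w 0 p) (w 1 p) (t 0 p) (t 1 p) (kappa (p 0 0)) s1 s2 s3 => w0 w1 t0 t1 k s1 s2 s3.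
by congr (hvec p _ _ _); [ring|field: s2 s1|ring].
Qed.

Hypothesis kappa_const : forall s, I s -> is_derive s 1 kappa 0.

Lemma nabla_hopf_normal (f : R -> R) q u : I (q 0 0) ->
  is_derive (q 0 0) 1 f 0 ->
  nabla_along g phi (fun p => hvec p 0 (f (p 0 0)) 0) q u =
  hvec q (- (f (q 0 0) * (kappa (q 0 0) * u 0 0 - l / 2 * theta q u))) 0
         (l / 2 * u 0 0 * f (q 0 0)).
Proof.
move=> Iq df; have dc := is_derive_fun_cst q u (0 : R).
rewrite (nabla_hopf l oI gammaP Iq dc (is_derive_comp_coord u df) dc).
by congr (hvec q _ _ _); ring.
Qed.

(** Stated for f N with any locally constant f, so that it can be iterated. Each direction
    contributes the squared length of nabla_{E_i} N, so the factor is the squared norm of the second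
    fundamental form. *)
Lemma hopf_rough_laplacian (V : 'rV[R]_2 -> 'rV[R]_3) (f : R -> R) p :
  (forall s, I s -> is_derive s 1 f 0) ->
  (forall q, W q -> V q = hvec q 0 (f (q 0 0)) 0) -> W p ->
  rough_laplacian g phi E V p =
  hvec p 0 (f (p 0 0) * (kappa (p 0 0) ^+ 2 + l ^+ 2 / 2)) 0.
Proof.
move=> f0 VE Wp; have Ip := WI Wp; have [s1 s2 s3] := frame_sums Wp.
have nV q u : W q -> nabla_along g phi V q u =
    hvec q (- (f (q 0 0) * (kappa (q 0 0) * u 0 0 - l / 2 * theta q u))) 0
         (l / 2 * u 0 0 * f (q 0 0)).
  move=> Wq; rewrite (nabla_along_eq _ _ _ oW Wq VE).
  exact: nabla_hopf_normal (WI Wq) (f0 _ (WI Wq)).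
have T i : nabla_along g phi (fun q => nabla_along g phi V q (E i q)) p (E i p)
     - nabla_along g phi V p (nabla ig (E i) (E i) p) =
   hvec p 0 (- f (p 0 0) * ((kappa (p 0 0) * w i p - l / 2 * t i p) ^+ 2
                            + l ^+ 2 / 4 * w i p ^+ 2)) 0.
  have [dw [dt [dw' dt' nw nt]]] := frame_derive i Wp.
  pose al q := - (f (q 0 0) * (kappa (q 0 0) * w i q - l / 2 * t i q)).
  pose de q := l / 2 * w i q * f (q 0 0).
  rewrite (nabla_along_eq _ _ _ oW Wp
    (V' := fun q => hvec q (al q) 0 (de q))); last first.
    by move=> q Wq; rewrite nV.
  have df := is_derive_comp_coord (E i p) (f0 _ Ip).
  have dk := is_derive_comp_coord (E i p) (kappa_const Ip).
  have dal : is_derive p (E i p) al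
      (- (f (p 0 0) * (kappa (p 0 0) * dw - l / 2 * dt))).
    by rewrite /al; is_derive_tac; ring.
  have dde : is_derive p (E i p) de (l / 2 * dw * f (p 0 0)).
    by rewrite /de; is_derive_tac; ring.
  rewrite (nabla_hopf l oI gammaP Ip dal (is_derive_fun_cst _ _ 0) dde) nV //.
  rewrite nw nt hopf_vec_opp hopf_vec_add.
  by rewrite /al /de -/(w i p) -/(t i p); congr (hvec p _ _ _); field.
rewrite /rough_laplacian (eq_bigr _ (fun i _ => T i)) sum2
  hopf_vec_add hopf_vec_opp.
clear T nV.
move: (w 0 p) (w 1 p) (t 0 p) (t 1 p) (kappa (p 0 0)) (f (p 0 0)) s1 s2 s3.
move=> w0 w1 t0 t1 k h s1 s2 s3.
by congr (hvec p _ _ _); [ring|field: s2 s1 s3|ring].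
Qed.

(** The three terms have normal coefficients kappa (kappa^2 + l^2/2)^2, kappa (kappa^2 + l^2/2) (4 m
    - l^2/2) and kappa^3 (4 m - 3 l^2/4). Subtracting the last two from the first leaves a
    polynomial that factors as stated. *)
Lemma hopf_tritension p : W p ->
  let k2 := kappa (p 0 0) ^+ 2 in
  tritension g phi E p =
  hvec p 0 (kappa (p 0 0) * (k2 - 2 * (4 * m - l ^+ 2)) * (k2 + l ^+ 2 / 4)) 0.
Proof.
move=> Wp k2; have Ip := WI Wp; have [s1 s2 s3] := frame_sums Wp.
have LV q : W q -> rough_laplacian g phi E (tension g phi E) q =
    hvec q 0 (kappa (q 0 0) * (kappa (q 0 0) ^+ 2 + l ^+ 2 / 2)) 0.
  exact: hopf_rough_laplacian kappa_const hopf_tension.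
have LL : rough_laplacian g phi E (rough_laplacian g phi E (tension g phi E)) p =
    hvec p 0 (kappa (p 0 0) * (kappa (p 0 0) ^+ 2 + l ^+ 2 / 2) *
              (kappa (p 0 0) ^+ 2 + l ^+ 2 / 2)) 0.
  apply: (hopf_rough_laplacian
    (f := fun s => kappa s * (kappa s ^+ 2 + l ^+ 2 / 2)) _ LV Wp).
  by move=> s /kappa_const dk; is_derive_tac; ring.
have nT i : nabla_along g phi (tension g phi E) p (E i p) =
    hvec p (- (kappa (p 0 0) * (kappa (p 0 0) * w i p - l / 2 * t i p))) 0
         (l / 2 * w i p * kappa (p 0 0)).
  rewrite (nabla_along_eq _ _ _ oW Wp hopf_tension).
  exact: nabla_hopf_normal Ip (kappa_const Ip).
have C1 i : curvature_at g (phi p) (rough_laplacian g phi E (tension g phi E) p)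
    ('D_(E i p) phi p) ('D_(E i p) phi p) =
  hvec p 0 (kappa (p 0 0) * (kappa (p 0 0) ^+ 2 + l ^+ 2 / 2) *
    ((4 * m - 3 / 4 * l ^+ 2) * w i p * w i p + l ^+ 2 / 4 * t i p * t i p)) 0.
  rewrite (LV _ Wp) (derive_hopf_cylinder l gammaP _ Ip).
  exact: (hopf_curvature l gammaP _ _ _ _ _ Ip).
have C2 i : curvature_at g (phi p) (nabla_along g phi (tension g phi E) p (E i p))
    (tension g phi E p) ('D_(E i p) phi p) =
  hvec p 0 (kappa (p 0 0) ^+ 2 *
    ((4 * m - 3 / 4 * l ^+ 2) * (kappa (p 0 0) * w i p - l / 2 * t i p) * w i p
     - l ^+ 2 / 4 * (l / 2 * w i p) * t i p)) 0.
  rewrite (nT i) (hopf_tension Wp) (derive_hopf_cylinder l gammaP _ Ip).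
  rewrite curvature_at_antisym (hopf_curvature l gammaP _ _ _ _ _ Ip) hopf_vec_opp.
  rewrite -/(w i p) -/(t i p).
  by move: (w i p) (t i p) (kappa _) => w0 t0 k; congr (hvec p _ _ _); field.
have -> : tritension g phi E p =
    hvec p 0 (kappa (p 0 0) * (kappa (p 0 0) ^+ 2 + l ^+ 2 / 2) *
              (kappa (p 0 0) ^+ 2 + l ^+ 2 / 2)) 0
    - \sum_(i < 2) hvec p 0 (kappa (p 0 0) * (kappa (p 0 0) ^+ 2 + l ^+ 2 / 2) *
      ((4 * m - 3 / 4 * l ^+ 2) * w i p * w i p + l ^+ 2 / 4 * t i p * t i p)) 0
    - \sum_(i < 2) hvec p 0 (kappa (p 0 0) ^+ 2 *
      ((4 * m - 3 / 4 * l ^+ 2) * (kappa (p 0 0) * w i p - l / 2 * t i p) * w i p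
       - l ^+ 2 / 4 * (l / 2 * w i p) * t i p)) 0.
  congr (_ - _ - _); first exact: LL.
    by apply: eq_bigr => i _; exact: C1.
  by apply: eq_bigr => i _; exact: C2.
rewrite !sum2 !hopf_vec_add !hopf_vec_opp !hopf_vec_add.
rewrite /k2 {k2}; clear LV LL nT C1 C2.
move: (w 0 p) (w 1 p) (t 0 p) (t 1 p) (kappa (p 0 0)) s1 s2 s3 => w0 w1 t0 t1 k s1 s2 s3.
by congr (hvec p _ _ _); [ring|field: s2 s1 s3|ring].
Qed.

End hopf_tritension.

(** * Smoothness of the adapted frame *)

(** A first-order expansion of [h] at [p] is also one of [f], and [diff_unique] recognizes its
    continuous linear part as the differential of [f]. *)
Lemma differentiable_open_eq (R : numFieldType) (V W : normedModType R) (A : set V)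
    (f h : V -> W) p :
  open A -> A p -> (forall q, A q -> f q = h q) ->
  differentiable h p -> differentiable f p.
Proof.
move=> oA Ap fh dh.
have nfh : \forall q \near p, f q = h q by exact: near_open fh.
have E : f \o shift p = cst (f p) + 'd h p +o_ 0 id.
  apply/eqaddoP => e e0; have /eqaddoP/(_ e e0) H := diff_locally dh.
  move: nfh; rewrite (near_shift 0 p) => /(filterI H); apply: filterS => x [].
  by rewrite /= subr0 !fctE /= (fh p Ap) => + ->.
have dE := diff_unique (diff_continuous dh) E.
by apply/diff_locallyP; rewrite dE; split => //; exact: diff_continuous.
Qed.

Section smooth_functions_of_a_real_variable.
Context {R : realType} (I : set R) (oI : open I).
Implicit Types f h : R -> R.

(** Level k asks for k + 1 derivatives on [I]; smoothness is the conjunction over all k. *)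
Fixpoint cont_diff (k : nat) f : Prop :=
  (forall s, I s -> derivable f s 1) /\
  if k is k'.+1 then cont_diff k' (derive1 f) else True.

Lemma cont_diff_derivable k f s : cont_diff k f -> I s -> derivable f s 1.
Proof. by case: k => [|k] /= [+ _]; apply. Qed.

Lemma cont_diffW k f : cont_diff k.+1 f -> cont_diff k f.
Proof.
by elim: k f => [|k IH] f /= [df df']; split => //; exact: IH.
Qed.

Lemma cont_diff_eq k f h : (forall s, I s -> f s = h s) ->
  cont_diff k f -> cont_diff k h.
Proof.
have D f' h' s : (forall s, I s -> f' s = h' s) -> I s -> derivable f' s 1 ->
    derivable h' s 1.
  by move=> fh Is; apply: near_eq_derivable; exact: near_open fh.
elim: k f h => [|k IH] f h fh /= [df df']; split => //.
- by move=> s Is; apply: D (df s Is).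
- by move=> s Is; apply: D (df s Is).
apply: IH df' => s Is; rewrite !derive1E; apply: near_eq_derive.
exact: near_open fh.
Qed.

Lemma cont_diffS k f f' : (forall s, I s -> is_derive s 1 f (f' s)) ->
  cont_diff k f' -> cont_diff k.+1 f.
Proof.
move=> ff' Cf'; split; first by move=> s /ff'[].
apply: cont_diff_eq Cf' => s /ff' df.
by rewrite derive1E (@derive_val _ _ _ _ _ _ _ df).
Qed.

Lemma cont_diff_is_derive k f s : cont_diff k f -> I s -> is_derive s 1 f (derive1 f s).
Proof. by move=> /cont_diff_derivable d /d df; rewrite derive1E; exact: derivableP. Qed.

Lemma cont_diff_cst k (c : R) : cont_diff k (fun _ => c).
Proof.
elim: k c => [|k IH] c.
  by split => // s _; case: (is_derive_fun_cst s 1 c).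
by apply: (cont_diffS (f' := fun _ => 0)) => // s _; exact: is_derive_fun_cst.
Qed.

Lemma cont_diff_add k f h : cont_diff k f -> cont_diff k h ->
  cont_diff k (fun s => f s + h s).
Proof.
elim: k f h => [|k IH] f h Cf Ch.
  by split => // s Is; case: (is_derive_fun_add (cont_diff_is_derive Cf Is)
    (cont_diff_is_derive Ch Is)).
apply: (cont_diffS (f' := fun s => derive1 f s + derive1 h s)) => [s Is|].
  exact: is_derive_fun_add (cont_diff_is_derive Cf Is) (cont_diff_is_derive Ch Is).
by apply: IH; [case: Cf|case: Ch].
Qed.

Lemma cont_diff_mul k f h : cont_diff k f -> cont_diff k h ->
  cont_diff k (fun s => f s * h s).
Proof.
elim: k f h => [|k IH] f h Cf Ch.
  by split => // s Is; case: (is_derive_fun_mul (cont_diff_is_derive Cf Is)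
    (cont_diff_is_derive Ch Is)).
apply: (cont_diffS (f' := fun s => f s * derive1 h s + h s * derive1 f s)) => [s Is|].
  exact: is_derive_fun_mul (cont_diff_is_derive Cf Is) (cont_diff_is_derive Ch Is).
by apply: cont_diff_add; apply: IH; by [exact: cont_diffW|case: Cf|case: Ch].
Qed.

Lemma cont_diff_opp k f : cont_diff k f -> cont_diff k (fun s => - f s).
Proof.
move=> Cf; apply: cont_diff_eq (cont_diff_mul (cont_diff_cst k (-1)) Cf) => s _.
by rewrite mulN1r.
Qed.

(** The derivative of 1/f is a product containing 1/f itself, to which the induction hypothesis
    applies one order lower. *)
Lemma cont_diff_inv k f : (forall s, I s -> f s != 0) -> cont_diff k f ->
  cont_diff k (fun s => (f s)^-1).
Proof.
move=> f0; elim: k => [|k IH] Cf.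
  split => // s Is.
  by case: (is_derive_fun_inv (f0 s Is) (cont_diff_is_derive Cf Is)).
have Ci := IH (cont_diffW Cf).
apply: (cont_diffS (f' := fun s => - ((f s)^-1 * (f s)^-1) * derive1 f s)) => [s Is|].
  apply: is_derive_eq (is_derive_fun_inv (f0 s Is) (cont_diff_is_derive Cf Is)) _.
  by rewrite -exprVn.
apply: cont_diff_mul; last by case: Cf.
by apply: cont_diff_opp; exact: cont_diff_mul.
Qed.

(* Partial derivatives of fields of this form are again of this form. *)
Lemma smooth_on_hopf_field (c f : R -> R) :
  (forall k, cont_diff k c) -> (forall k, cont_diff k f) ->
  smooth_on (hopf_domain I)
   (fun q : 'rV[R]_2 => c (q 0 0) *: delta_mx 0 0 + f (q 0 0) *: delta_mx 0 1 : 'rV[R]_2).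
Proof.
move=> Cc Cf.
pose G (c f : R -> R) (q : 'rV[R]_2) : 'rV[R]_2 :=
  c (q 0 0) *: delta_mx 0 0 + f (q 0 0) *: delta_mx 0 1.
have oD : open (hopf_domain I : set 'rV[R]_2) by exact: open_hopf_domain.
have dG c' f' p : (forall k, cont_diff k c') -> (forall k, cont_diff k f') ->
    hopf_domain I p -> differentiable (G c' f') p.
  have H (h : R -> R) (v : 'rV[R]_2) : (forall k, cont_diff k h) -> hopf_domain I p ->
      differentiable (fun q : 'rV[R]_2 => h (q 0 0) *: v) p.
    move=> Ch Dp; apply: differentiableZl.
    apply: (differentiable_comp (g := h)); first exact: differentiable_coord.
    by apply/derivable1_diffP; exact: (cont_diff_derivable (Ch 0%N)).
  by move=> Cc' Cf' Dp; apply: differentiableD; exact: H.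
suff K s : exists c' f', [/\ forall k, cont_diff k c', forall k, cont_diff k f' &
    forall q, hopf_domain I q -> iter_partial s (G c f) q = G c' f' q].
  move=> s p Dp; have [c' [f' [Cc' Cf' E]]] := K s.
  exact: (differentiable_open_eq oD Dp E (dG _ _ _ Cc' Cf' Dp)).
elim: s => [|i s [c' [f' [Cc' Cf' E]]]]; first by exists c, f.
exists (fun s => derive1 c' s * (delta_mx 0 i : 'rV[R]_2) 0 0),
  (fun s => derive1 f' s * (delta_mx 0 i : 'rV[R]_2) 0 0).
split.
- by move=> k; apply: cont_diff_mul (cont_diff_cst _ _); case: (Cc' k.+1).
- by move=> k; apply: cont_diff_mul (cont_diff_cst _ _); case: (Cf' k.+1).
move=> q Dq /=; rewrite (near_eq_derive _ (near_open oD Dq E)).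
apply: derive_val; apply: is_derive_row.
have dc := is_derive_comp_coord (delta_mx 0 i) (cont_diff_is_derive (Cc' 0%N) Dq).
have df := is_derive_comp_coord (delta_mx 0 i) (cont_diff_is_derive (Cf' 0%N) Dq).
have GE c0 f0 p j : G c0 f0 p 0 j =
    c0 (p 0 0) * (delta_mx 0 0 : 'rV[R]_2) 0 j +
    f0 (p 0 0) * (delta_mx 0 1 : 'rV[R]_2) 0 j.
  by rewrite /G mxE [X in X + _]mxE [X in _ + X]mxE.
move=> j; rewrite GE; under eq_fun do rewrite GE.
by is_derive_tac; ring.
Qed.

End smooth_functions_of_a_real_variable.

(** * The frame (T, xi) and the constancy of the curvature *)

Section hopf_adapted_frame.
Context {R : realType} (m l : R) (I : set R) (gamma : R -> 'rV[R]_2).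
Hypotheses (oI : open I) (gammaP : arclength_curve m I gamma).
Local Notation X j s := (curve_jet gamma j s 0).
Local Notation Y j s := (curve_jet gamma j s 1).
Local Notation kappa := (curvature_fun m gamma).
Local Notation conn := (curve_conn m l gamma).
Local Notation theta := (hopf_theta m l gamma).
Local Notation hvec := (hopf_vec m l gamma).
Local Notation phi := (hopf_cylinder gamma).
Local Notation g := (bcv_metric m l).
Implicit Types (p q u v : 'rV[R]_2).

Lemma cont_diff_curve_jet k j i : cont_diff I k (fun s => curve_jet gamma j s i).
Proof.
elim: k j => [|k IH] j.
  by split => // s Is; case: (is_derive_curve_jet gammaP j i Is).
apply: (cont_diffS oI (f' := fun s => curve_jet gamma j.+1 s i)) => // s Is.
exact: (is_derive_curve_jet gammaP).
Qed.

Lemma cont_diff_curve_conn k : cont_diff I k conn.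
Proof.
have J j i := cont_diff_curve_jet k j i; have C c := cont_diff_cst oI k c.
have F0 s : I s -> curve_factor m gamma s != 0 by exact: (curve_factor_neq0 gammaP).
have CM f h := @cont_diff_mul _ _ oI k f h.
have CD f h := @cont_diff_add _ _ oI k f h.
have F2 := CD _ _ (C 1) (CM _ _ (C m)
  (CD _ _ (CM _ _ (J 0 0) (J 0 0)) (CM _ _ (J 0 1) (J 0 1)))).
apply: (CM _ _ (CM _ _ (C (l / 2)) (cont_diff_inv oI F0 F2))).
exact: CD (CM _ _ (J 0 1) (J 1 0)) (cont_diff_opp oI (CM _ _ (J 0 0) (J 1 1))).
Qed.

(** T and xi in the chart, in the shape required by [smooth_on_hopf_field]. Being defined on the
    whole domain, this frame lets hypotheses about all local frames be used at every point. *)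
Definition hopf_frame (i : 'I_2) q : 'rV[R]_2 :=
  (i == 0)%:R *: delta_mx 0 0 + (if i == 0 then - conn (q 0 0) else 1) *: delta_mx 0 1.

Lemma hopf_frameP : local_frame g phi (hopf_domain I) (hopf_domain I) hopf_frame.
Proof.
split; first by [].
split; first exact: open_hopf_domain.
  move=> i.
  apply: (@smooth_on_hopf_field _ _ oI (fun _ => (i == 0)%:R)
    (fun s => if i == 0 then - conn s else 1)) => k; first exact: cont_diff_cst.
  by case: (i == 0); [apply: cont_diff_opp => //; exact: cont_diff_curve_conn
                     |exact: cont_diff_cst].
move=> p Dp i j; rewrite (induced_inner l gammaP _ _ Dp) /hopf_theta.
have E k : hopf_frame k p 0 0 = (k == 0)%:R.
  by rewrite !mxE /= mulr1 mulr0 addr0.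
have E1 k : hopf_frame k p 0 1 = if k == 0 then - conn (p 0 0) else 1.
  by rewrite !mxE /= mulr1 mulr0 add0r.
rewrite !E !E1; move: i; apply: ord2_ind; move: j; apply: ord2_ind => /=; ring.
Qed.

Lemma hopf_vec_surj p (v : 'rV[R]_3) : I (p 0 0) ->
  exists a b c, v = hvec p a b c.
Proof.
move=> Ip; have F0 := curve_factor_neq0 gammaP Ip.
have v1 := curve_speed gammaP Ip.
pose F := curve_factor m gamma (p 0 0).
(* Euclidean projections on the velocity and its rotation, both of squared Euclidean length F^2. *)
exists ((v 0 0 * X 1 (p 0 0) + v 0 1 * Y 1 (p 0 0)) / F ^+ 2),
  ((v 0 1 * X 1 (p 0 0) - v 0 0 * Y 1 (p 0 0)) / F ^+ 2), (bcv_omega m l (phi p) v).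
apply: bcv_lift_eq => //; rewrite /F; move: F0 v1;
move: (v 0 0) (v 0 1) (X 1 (p 0 0)) (Y 1 (p 0 0)) (curve_factor _ _ _).
  by move=> a b x y h h0 v1; field: v1.
by move=> a b x y h h0 v1; field: v1.
Qed.

Lemma hopf_vec_eq0 p b : I (p 0 0) -> (hvec p 0 b 0 = 0) <-> (b = 0).
Proof.
move=> Ip; split=> [H|->]; last first.
  by rewrite -(scale0r (hvec p 0 0 0)) hopf_vec_scale !mulr0.
have := inner_hopf_vec l gammaP 0 b 0 0 b 0 Ip.
rewrite H /inner trmx0 mulmx0 mxE !mul0r add0r addr0 => /esym/eqP.
by rewrite mulf_eq0 orbb => /eqP.
Qed.

(** The given unit normal is N or - N at each point, and the mean curvature is half the tension, so
    that kappa^2 = 4 c^2. No sign has to be followed along the curve: differentiating gives kappa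
    kappa' = 0, and if kappa vanishes at one point then c = 0 and kappa vanishes on all of [I]. *)
Lemma cmc_curvature_const : cmc g phi (hopf_domain I) ->
  forall s, I s -> is_derive s 1 kappa 0.
Proof.
move=> [N [[_ NP] [c HN]]].
have k2 s : I s -> kappa s ^+ 2 = 4 * c ^+ 2.
  move=> Is; pose p : 'rV[R]_2 := s *: delta_mx 0 0.
  have p0 : p 0 0 = s by rewrite !mxE mulr1.
  have Dp : hopf_domain I p by rewrite /hopf_domain /= p0.
  have [n1 nT] := NP p Dp; have [a [b [d Nv]]] := hopf_vec_surj (N p) Dp.
  have nT' u : a * u 0 0 + d * theta p u = 0.
    have := nT u; rewrite Nv (derive_hopf_cylinder l gammaP _ Dp).
    by rewrite (inner_hopf_vec l gammaP _ _ _ _ _ _ Dp) mulr0 addr0.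
  have d0 : d = 0.
    by have := nT' (delta_mx 0 1); rewrite /hopf_theta !delta2E !mulr0 addr0 mulr1 add0r.
  have a0 : a = 0.
    by have := nT' (delta_mx 0 0); rewrite d0 mul0r addr0 delta2E mulr1.
  have b1 : b ^+ 2 = 1.
    move: n1; rewrite Nv (inner_hopf_vec l gammaP _ _ _ _ _ _ Dp) a0 d0.
    by rewrite !mulr0 add0r addr0.
  have := HN _ _ hopf_frameP p Dp.
  rewrite /mean_curvature /mean_curvature_vector (hopf_tension oI gammaP hopf_frameP Dp).
  rewrite hopf_vec_scale Nv (inner_hopf_vec l gammaP _ _ _ _ _ _ Dp) p0 => <-.
  by rewrite a0 d0; field: b1.
move=> s Is; have [k' dk] := is_derive_curvature_fun gammaP Is.
have [k0|k0] := eqVneq (kappa s) 0.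
  have c0 : c = 0.
    have /esym/eqP := k2 s Is; rewrite k0 expr0n /= mulf_eq0 pnatr_eq0 /=.
    by rewrite sqrf_eq0 => /eqP.
  apply: (is_derive_open_eq (f := fun _ => 0) oI Is) (is_derive_fun_cst _ _ _).
  by move=> t /k2/eqP; rewrite c0 expr0n /= mulr0 sqrf_eq0 => /eqP.
have d1 : is_derive s 1 (fun s => kappa s ^+ 2) (2 * kappa s * k').
  by is_derive_tac; ring.
have d0 : is_derive s 1 (fun s => kappa s ^+ 2) 0.
  apply: (is_derive_open_eq (f := fun _ => 4 * c ^+ 2) oI Is) (is_derive_fun_cst _ _ _).
  by move=> t /k2.
have /eqP := is_derive_unique d1 d0.
rewrite !mulf_eq0 pnatr_eq0 (negbTE k0) /= => /eqP k'0.
by rewrite -k'0.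
Qed.

End hopf_adapted_frame.

Theorem theorem2p2 (R : realType) (m l : R) (I : set R)
    (gamma : R -> 'rV[R]_2)
    (HIopen : open I) (HIitv : is_interval I) (HIne : I !=set0)
    (Hgamma : arclength_curve m I gamma)
    (Hcmc : cmc (bcv_metric m l) (hopf_cylinder gamma) (hopf_domain I)) :
  (4 * m <= l ^+ 2 ->
   triharmonic (bcv_metric m l) (hopf_cylinder gamma) (hopf_domain I) ->
   minimal (bcv_metric m l) (hopf_cylinder gamma) (hopf_domain I))
  /\
  (l ^+ 2 < 4 * m ->
   (forall s, I s -> geodesic_curvature m gamma s ^+ 2 = 2 * (4 * m - l ^+ 2)) ->
   proper_triharmonic (bcv_metric m l) (hopf_cylinder gamma) (hopf_domain I)).
Proof.
have kc := cmc_curvature_const HIopen Hgamma Hcmc.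
have fr := hopf_frameP l HIopen Hgamma.
split=> [ml tri W E frE p Wp|lm geo].
  have Ip : I (p 0 0) by case: frE => + _; apply.
  rewrite /mean_curvature_vector (hopf_tension HIopen Hgamma frE Wp).
  have k0 : curvature_fun m gamma (p 0 0) = 0.
    have /(hopf_vec_eq0 l Hgamma _ Ip) := etrans (esym
      (hopf_tritension HIopen Hgamma fr kc Ip)) (tri _ _ fr _ Ip).
    move: (curvature_fun _ _ _) => k /eqP; apply: contraTeq => k0.
    have kp : 0 < k ^+ 2 by rewrite exprn_even_gt0.
    have lp0 : 0 <= l ^+ 2 by exact: sqr_ge0.
    (* As 4 m <= l^2, both remaining factors are at least k^2 > 0. *)
    rewrite !mulf_neq0 // lt0r_neq0 //; lra.
  by rewrite k0 ((hopf_vec_eq0 l Hgamma 0 Ip).2 erefl) scaler0.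
have k2 s : I s -> curvature_fun m gamma s ^+ 2 = 2 * (4 * m - l ^+ 2).
  by move=> Is; rewrite -(geodesic_curvatureE Hgamma Is) geo.
split.
  move=> W E frE p Wp; have Ip : I (p 0 0) by case: frE => + _; apply.
  rewrite (hopf_tritension HIopen Hgamma frE kc Wp) k2 // subrr mulr0 mul0r.
  exact: ((hopf_vec_eq0 l Hgamma 0 Ip).2 erefl).
(* One point suffices: minimality there gives kappa = 0, against kappa^2 = 2 (4 m - l^2) > 0. *)
case: HIne => s Is min; pose p : 'rV[R]_2 := s *: delta_mx 0 0.
have p0 : p 0 0 = s by rewrite !mxE mulr1.
have Dp : hopf_domain I p by rewrite /hopf_domain /= p0.
have := min _ _ fr p Dp.
rewrite /mean_curvature_vector (hopf_tension HIopen Hgamma fr Dp) hopf_vec_scale !mulr0.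
move=> /(hopf_vec_eq0 l Hgamma _ Dp)/eqP; rewrite p0 mulf_eq0 invr_eq0 pnatr_eq0 /=.
move=> /eqP k0.
have := k2 s Is; rewrite k0 expr0n /= => /esym/eqP; rewrite mulf_eq0 pnatr_eq0 /=.
by rewrite subr_eq0 gt_eqF.
Qed.
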